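(* The planar system $$\frac{dx}{dt}=-y,\qquad \frac{dy}{dt}=x(x+1)(x^2+\beta x+\alpha)$$ with $\beta=-1$ and $\alpha=\frac12$ has exactly two critical periods.
   Context: The system is Hamiltonian with $H(x,y)=\frac{y^2}{2}+G(x)$, where $G(x)=\int_0^x g(s)\,ds$ and $g(x)=x(x+1)(x^2+\beta x+\alpha)$. For $\beta^2-4\alpha<0$ its only real equilibria are the nondegenerate center $O(0,0)$ and the hyperbolic saddle $S(-1,0)$. The period annulus of $O$ (the largest punctured neighborhood of $O$ foliated by periodic orbits) surrounds only $O$ and is bounded on the outside by a homoclinic loop at $S$. It consists of the periodic orbits $\Gamma_h\subset\{H=h\}$ around $O$ for $h\in(0,h_s)$, $h_s=G(-1)$. The period function $T:(0,h_s)\to(0,+\infty)$ assigns to $h$ the minimal period of $\Gamma_h$: $$T(h)=\sqrt2\int_{x_-(h)}^{x_+(h)}\frac{dx}{\sqrt{h-G(x)}},$$ where $-1<x_-(h)<0<x_+(h)$ are the abscissas of the intersection points of $\Gamma_h$ with the $x$-axis, so $G(x_\pm(h))=h$. A critical period of the system is a local maximum or local minimum of $T$ in $(0,h_s)$. *)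

(* Defs.v *)
From Stdlib Require Import Reals.
From Coquelicot Require Import Coquelicot.
Open Scope R_scope.

Definition g (alpha beta x : R) : R :=
  x * (x + 1) * (x ^ 2 + beta * x + alpha).

Definition G (alpha beta x : R) : R := RInt (g alpha beta) 0 x.

Definition H (alpha beta : R) (p : R * R) : R :=
  snd p ^ 2 / 2 + G alpha beta (fst p).

Definition solution (alpha beta : R) (x y : R -> R) : Prop :=
  forall t : R,
    is_derive x t (- y t) /\ is_derive y t (g alpha beta (x t)).

Definition is_period (x y : R -> R) (tau : R) : Prop :=
  0 < tau /\ forall t : R, x (t + tau) = x t /\ y (t + tau) = y t.

(* Equilibria have no minimal period: every tau > 0 is a period. *)
Definition is_minimal_period (x y : R -> R) (tau : R) : Prop :=
  is_period x y tau /\ forall s : R, is_period x y s -> tau <= s.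

Definition periodic_orbit (alpha beta : R) (Gamma : R * R -> Prop) (tau : R)
  : Prop :=
  exists x y : R -> R,
    solution alpha beta x y /\
    is_minimal_period x y tau /\
    forall p : R * R, Gamma p <-> exists t : R, p = (x t, y t).

Definition origin : R * R := (0, 0).

Definition connected (W : R * R -> Prop) : Prop :=
  forall A B : R * R -> Prop,
    open A -> open B ->
    (forall p, W p -> A p \/ B p) ->
    (exists p, W p /\ A p) -> (exists p, W p /\ B p) ->
    exists p, W p /\ A p /\ B p.

Definition punctured_neighborhood (U : R * R -> Prop) : Prop :=
  ~ U origin /\
  open (fun p => U p \/ p = origin) /\
  connected (fun p => U p \/ p = origin).

(* Distinct orbits are disjoint, so covering U by periodic orbits contained
   in U is the same as foliating it. *)
Definition foliated_by_periodic_orbits (alpha beta : R) (U : R * R -> Prop)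
  : Prop :=
  forall p : R * R, U p ->
    exists (Gamma : R * R -> Prop) (tau : R),
      periodic_orbit alpha beta Gamma tau /\
      Gamma p /\ (forall q, Gamma q -> U q).

(* A union of punctured neighborhoods foliated by periodic orbits is again
   one, so (the origin being a center) this union is the largest of them. *)
Definition period_annulus (alpha beta : R) (p : R * R) : Prop :=
  exists U : R * R -> Prop,
    punctured_neighborhood U /\
    foliated_by_periodic_orbits alpha beta U /\
    U p.

Definition h_s (alpha beta : R) : R := G alpha beta (-1).

(* [unique] determines T on (0, h_s); its values elsewhere are irrelevant. *)
Definition is_period_function (alpha beta : R) (T : R -> R) : Prop :=
  forall h : R, 0 < h < h_s alpha beta ->
    unique
      (fun tau => exists Gamma : R * R -> Prop,
         periodic_orbit alpha beta Gamma tau /\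
         forall p, Gamma p -> period_annulus alpha beta p /\ H alpha beta p = h)
      (T h).

Definition local_max (T : R -> R) (h : R) : Prop :=
  locally h (fun k => T k <= T h).

Definition local_min (T : R -> R) (h : R) : Prop :=
  locally h (fun k => T h <= T k).

Definition critical_period (alpha beta : R) (T : R -> R) (h : R) : Prop :=
  0 < h < h_s alpha beta /\ (local_max T h \/ local_min T h).

Definition exactly_two (P : R -> Prop) : Prop :=
  exists h1 h2 : R, h1 <> h2 /\ forall h : R, P h <-> h = h1 \/ h = h2.

(* Main.v *)
Require Import Defs.
From Stdlib Require Import Reals Ranalysis5 Lra ZArith List ClassicalEpsilon.
From Coquelicot Require Import Coquelicot.
Open Scope R_scope.

(** Write 2 G x = x^2 p x / 30 = (U x)^2 with U x = x sqrt (p x / 30).  On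
    x > -1 the map U is an increasing change of coordinate; let X be its
    inverse.  The level H = h becomes the circle u^2 + y^2 = r^2 with
    r^2 = 2 h, and on u = r cos t, y = r sin t time runs at the rate
    X' (r cos t).  Inverting the time map gives every periodic orbit
    explicitly, and their period is

      T = integral over [0, 2 PI] of X' (r cos t)
        = 2 * integral over [0, PI/2] of e0 (r cos t),
      where e0 u = X' u + X' (- u).

    With e1, e2 the derivatives of e0, both e1 u and u * e2 u are rational
    functions of the two abscissas x = X u > 0 > z = X (- u) of a level, because
    the square of X' is the rational function w^2 = 2 p / (15 q^2) of X.

    At most two critical periods.  Let T1 be the integral of cos t * e1 (r cos t),
    so that T' = 2 T1 in the variable r.  The derivative of T1 / r is M / r^2,
    where M averages m0 u = u e2 u - e1 u = nu x - nu z, whose derivative is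
    m1 u = u (V x - V z).  Two sign facts hold: m0 < 0 as long as x <= 0.485
    ([m0_neg]) and m1 > 0 once x >= 0.485 ([m1_pos]).  Hence m0 is negative up
    to its zero a, if it has one, so M r < 0 for r <= a; and for r > a an integration by
    parts gives M' > 0 ([quarter_m1_pos]).  Once nonnegative, M is therefore
    positive from then on ([slope_sign_persists]): T1 / r decreases, then
    increases, and has at most two zeros.

    At least two.  T1 is positive for small r, negative for r^2 = 0.14 and
    positive for r^2 = 0.4 ([quarter_e1_signs]).

    All inequalities between functions of x and of z on the same level are
    proved by separation: as x^2 p x = z^2 p z, it is enough to find a
    polynomial in this common value lying between the two sides, which leaves
    inequalities between polynomials in one variable on explicit intervals.
    These are decided by the signs of Bernstein coefficients ([bernstein_pos]).

    The period is well defined because any periodic orbit on the level h in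
    (0, h_s) stays right of the saddle, meets the explicit orbit, and so is a
    time shift of it ([periodic_orbit_period]); and the region x > -1,
    0 < H < h_s is a punctured neighbourhood foliated by these orbits
    ([annulus_subset]). *)

(** * Certifying the sign of a polynomial on an interval *)

Fixpoint horner (l : list Z) (x : R) : R :=
  match l with nil => 0 | c :: l' => IZR c + x * horner l' x end.

Fixpoint padd (l m : list Z) : list Z :=
  match l, m with
  | nil, _ => m
  | _, nil => l
  | c :: l', d :: m' => (c + d)%Z :: padd l' m'
  end.

Definition pscale (k : Z) (l : list Z) : list Z := map (Z.mul k) l.

Fixpoint pmul (l m : list Z) : list Z :=
  match l with
  | nil => nil
  | c :: l' => padd (pscale c m) (0%Z :: pmul l' m)
  end.

Fixpoint ppow (l : list Z) (n : nat) : list Z :=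
  match n with O => 1%Z :: nil | S n' => pmul l (ppow l n') end.

Lemma horner_padd l m x : horner (padd l m) x = horner l x + horner m x.
Proof.
  revert m; induction l as [|c l IH]; intros [|d m]; simpl; try lra.
  rewrite IH, plus_IZR; lra.
Qed.

Lemma horner_pscale k l x : horner (pscale k l) x = IZR k * horner l x.
Proof.
  induction l as [|c l IH]; simpl; [lra|].
  fold (pscale k l); rewrite IH, mult_IZR; lra.
Qed.

Lemma horner_pmul l m x : horner (pmul l m) x = horner l x * horner m x.
Proof.
  induction l as [|c l IH]; simpl; [lra|].
  rewrite horner_padd, horner_pscale; simpl; rewrite IH; lra.
Qed.

Lemma horner_ppow l n x : horner (ppow l n) x = horner l x ^ n.
Proof.
  induction n as [|n IH]; simpl; [lra|]. rewrite horner_pmul, IH; lra.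
Qed.

(** Expressions are kept unexpanded so that the large products below are
    multiplied out by computation on integers instead of by [ring]. *)
Inductive pexpr : Set :=
  | PX | PC (c : Z) | PAdd (e f : pexpr) | PMul (e f : pexpr)
  | POpp (e : pexpr) | PPow (e : pexpr) (n : nat).

Fixpoint eval (e : pexpr) (x : R) : R :=
  match e with
  | PX => x
  | PC c => IZR c
  | PAdd e f => eval e x + eval f x
  | PMul e f => eval e x * eval f x
  | POpp e => - eval e x
  | PPow e n => eval e x ^ n
  end.

Fixpoint coeffs (e : pexpr) : list Z :=
  match e with
  | PX => 0%Z :: 1%Z :: nil
  | PC c => c :: nil
  | PAdd e f => padd (coeffs e) (coeffs f)
  | PMul e f => pmul (coeffs e) (coeffs f)
  | POpp e => pscale (-1) (coeffs e)
  | PPow e n => ppow (coeffs e) n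
  end.

Lemma horner_coeffs e x : horner (coeffs e) x = eval e x.
Proof.
  induction e as [|c|e He f Hf|e He f Hf|e He|e He n]; simpl.
  - lra.
  - lra.
  - now rewrite horner_padd, He, Hf.
  - now rewrite horner_pmul, He, Hf.
  - rewrite horner_pscale, He; simpl; lra.
  - now rewrite horner_ppow, He.
Qed.

(** The coefficients, up to a positive factor in t, of the polynomial after the
    substitution x = (a + b t) / (d (1 + t)), which maps t >= 0 onto
    [a/d, b/d); up to binomial factors these are Bernstein coefficients. *)
Fixpoint bernstein (a b d : Z) (l : list Z) : list Z :=
  match l with
  | nil => nil
  | c :: l' =>
      padd (pscale c (ppow (d :: d :: nil) (length l)))
           (pmul (a :: b :: nil) (bernstein a b d l'))
  end.

Lemma horner_bernstein a b d l t x :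
  IZR d * (1 + t) * x = IZR a + IZR b * t ->
  horner (bernstein a b d l) t = (IZR d * (1 + t)) ^ length l * horner l x.
Proof.
  intros Hx; induction l as [|c l IH]; [simpl; lra|].
  change (bernstein a b d (c :: l)) with
    (padd (pscale c (ppow (d :: d :: nil) (length (c :: l))))
          (pmul (a :: b :: nil) (bernstein a b d l))).
  rewrite horner_padd, horner_pscale, horner_ppow, horner_pmul, IH.
  replace (horner (d :: d :: nil) t) with (IZR d * (1 + t)) by (simpl; ring).
  replace (horner (a :: b :: nil) t) with (IZR d * (1 + t) * x)
    by (rewrite Hx; simpl; ring).
  simpl; ring.
Qed.

Definition positive_coeffs (l : list Z) : bool :=
  match l with
  | nil => false
  | c :: l' => (0 <? c)%Z && forallb (Z.leb 0) l'
  end.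

Lemma horner_nonneg l t :
  forallb (Z.leb 0) l = true -> 0 <= t -> 0 <= horner l t.
Proof.
  induction l as [|c l IH]; simpl; intros H Ht; [lra|].
  apply andb_prop in H as [Hc Hl]. apply Zle_bool_imp_le, IZR_le in Hc.
  specialize (IH Hl Ht). nra.
Qed.

(** Nonnegative coefficients in t make the value nonnegative for t >= 0, and a
    positive constant term makes it positive. *)
Lemma bernstein_pos (a b d : Z) l x :
  positive_coeffs (bernstein a b d l) = true ->
  (0 < d)%Z -> IZR a <= IZR d * x < IZR b -> 0 < horner l x.
Proof.
  intros H Hd [Ha Hb]. apply IZR_lt in Hd.
  set (t := (IZR d * x - IZR a) / (IZR b - IZR d * x)).
  assert (Ht : 0 <= t) by (apply Rdiv_le_0_compat; lra).
  assert (Hx : IZR d * (1 + t) * x = IZR a + IZR b * t)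
    by (unfold t; field; lra).
  pose proof (horner_bernstein a b d l t x Hx) as E.
  assert (HD : 0 < (IZR d * (1 + t)) ^ length l) by (apply pow_lt; nra).
  assert (0 < horner (bernstein a b d l) t).
  { destruct (bernstein a b d l) as [|c m]; simpl in *; [discriminate|].
    apply andb_prop in H as [Hc Hm]. apply Z.ltb_lt, IZR_lt in Hc.
    pose proof (horner_nonneg m t Hm Ht). nra. }
  nra.
Qed.

(** For polynomials with a triple zero at an interior point 0 of the interval:
    the cofactor of x^3 is tested. *)
Lemma bernstein_pos_cube (a b d : Z) l x :
  firstn 3 l = (0 :: 0 :: 0 :: nil)%Z ->
  positive_coeffs (bernstein a b d (skipn 3 l)) = true ->
  (0 < d)%Z -> IZR a <= IZR d * x < IZR b -> x <> 0 -> 0 < x * horner l x.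
Proof.
  intros H3 H Hd Hx Hx0.
  pose proof (bernstein_pos a b d _ x H Hd Hx) as Hl.
  rewrite <- (firstn_skipn 3 l), H3.
  set (m := skipn 3 l) in *; clearbody m; simpl.
  replace (x * (0 + x * (0 + x * (0 + x * horner m x))))
    with ((x ^ 2) ^ 2 * horner m x) by ring.
  apply Rmult_lt_0_compat; [|exact Hl].
  apply pow_lt, pow2_gt_0, Hx0.
Qed.

Ltac reify x e :=
  lazymatch e with
  | x => constr:(PX)
  | IZR ?c => constr:(PC c)
  | ?a + ?b => let a' := reify x a in let b' := reify x b in constr:(PAdd a' b')
  | ?a - ?b => let a' := reify x a in let b' := reify x b in constr:(PAdd a' (POpp b'))
  | ?a * ?b => let a' := reify x a in let b' := reify x b in constr:(PMul a' b')
  | - ?a => let a' := reify x a in constr:(POpp a')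
  | ?a ^ ?n => let a' := reify x a in constr:(PPow a' n)
  end.

Ltac poly_pos x a b d :=
  lazymatch goal with
  | |- 0 < ?e =>
      let e' := reify x e in
      change (0 < eval e' x); rewrite <- horner_coeffs;
      apply (bernstein_pos a b d);
      [ vm_compute; reflexivity | reflexivity | lra ]
  end.

(** * Integer polynomials of the potential and their signs *)

(** [p] and [q] are 60 G / x^2 and 2 g / x.  With
    w^2 = 2 p / (15 q^2), [n1], [n2], [n3] are the numerators of its first
    three derivatives: (w^2)^(k) = 2/15 * nk / q^(k+2). *)
Definition p x := 12 * x ^ 3 - 10 * x + 15.
Definition q x := 2 * x ^ 3 - x + 1.
Definition n1 x := - 72 * x ^ 5 + 88 * x ^ 3 - 144 * x ^ 2 - 10 * x + 20.
Definition n2 x :=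
  576 * x ^ 7 - 912 * x ^ 5 + 1656 * x ^ 4 + 160 * x ^ 3 - 240 * x ^ 2
  - 308 * x + 50.
Definition n3 x :=
  - 5760 * x ^ 9 + 11040 * x ^ 7 - 22464 * x ^ 6 - 1968 * x ^ 5 + 240 * x ^ 4
  + 13560 * x ^ 3 - 1200 * x ^ 2 - 1404 * x - 108.
(** 225 q^5 nu and 225 q^7 V for the functions [nu] and [V] below. *)
Definition nu_num x := x * p x * n2 x - 15 * n1 x * q x ^ 2.
Definition V_num x := 2 * n3 x * p x + n2 x * n1 x.

Ltac unfold_polys := unfold V_num, nu_num, n3, n2, n1, p, q.

(** The separating function of the level is here
    nu = - (900 + 112 x^2 p x) / 675, with the same jet of order two at 0 as
    nu, so that the difference has a triple zero. *)
Lemma nu_num_near_0 x : - 16 / 100 <= x <= 16 / 100 -> x <> 0 ->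
  0 < x * (- (900 + 112 * (x ^ 2 * p x)) * q x ^ 5 - 3 * nu_num x).
Proof.
  intros Hx Hx0; unfold_polys.
  lazymatch goal with |- 0 < x * ?e => let e' := reify x e in
    change (0 < x * eval e' x); rewrite <- horner_coeffs end.
  apply (bernstein_pos_cube (-16) 17 100);
    [vm_compute; reflexivity | vm_compute; reflexivity | reflexivity | lra | lra].
Qed.

(** Away from 0 the constant nu = - 1.6 separates the two sides. *)
Lemma nu_num_right x : 16 / 100 <= x <= 485 / 1000 ->
  nu_num x < - 360 * q x ^ 5.
Proof.
  intros Hx; apply Rlt_0_minus; unfold_polys. poly_pos x 16%Z 50%Z 100%Z.
Qed.

Lemma nu_num_left x : - 39 / 100 <= x <= 0 -> - 360 * q x ^ 5 < nu_num x.
Proof.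
  intros Hx; apply Rlt_0_minus; unfold_polys. poly_pos x (-40)%Z 1%Z 100%Z.
Qed.

Lemma V_num_pos x : 485 / 1000 <= x <= 76 / 100 -> 0 < V_num x.
Proof. intros Hx; unfold_polys. poly_pos x 48%Z 77%Z 100%Z. Qed.

Lemma V_num_neg x : -1 <= x <= - 37 / 100 -> V_num x < 0.
Proof.
  intros Hx; apply Rlt_0_minus; unfold_polys. poly_pos x (-100)%Z (-36)%Z 100%Z.
Qed.

(** For x >= 0.76 the value V x may be negative, but it stays above -30, the
    constant used here, and V z is then below it ([V_num_left]). *)
Lemma V_num_right x : 76 / 100 <= x <= 1 -> - 6750 * q x ^ 7 < V_num x.
Proof.
  intros Hx; apply Rlt_0_minus; unfold_polys. poly_pos x 76%Z 101%Z 100%Z.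
Qed.

Lemma V_num_left x : - 1 <= x <= - 6 / 10 -> V_num x < - 6750 * q x ^ 7.
Proof.
  intros Hx; apply Rlt_0_minus; unfold_polys. poly_pos x (-100)%Z (-59)%Z 100%Z.
Qed.

(** In terms of s = u^2 = x^2 p x / 30 these four bounds on W1 = (w^2)' are
    W1 x < 5.2 - 72 s, W1 z > 1.5 - 20 s, W1 x > 2 - 84 s + 175 s^2 and
    W1 z < 3 + 172 s - 660 s^2. *)
Lemma W1_upper_right x : 0 <= x <= 61 / 100 ->
  2 * n1 x < (78 - 36 * (x ^ 2 * p x)) * q x ^ 3.
Proof.
  intros Hx; apply Rlt_0_minus; unfold_polys. poly_pos x 0%Z 62%Z 100%Z.
Qed.

Lemma W1_lower_left x : - 49 / 100 <= x <= 0 ->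
  (45 - 20 * (x ^ 2 * p x)) * q x ^ 3 < 4 * n1 x.
Proof.
  intros Hx; apply Rlt_0_minus; unfold_polys. poly_pos x (-50)%Z 1%Z 100%Z.
Qed.

Lemma W1_lower_right x : 0 <= x <= 905 / 1000 ->
  (360 - 504 * (x ^ 2 * p x) + 35 * (x ^ 2 * p x) ^ 2) * q x ^ 3 < 24 * n1 x.
Proof.
  intros Hx; apply Rlt_0_minus; unfold_polys.
  destruct (Rlt_dec x (45 / 100)).
  - poly_pos x 0%Z 45%Z 100%Z.
  - poly_pos x 450%Z 906%Z 1000%Z.
Qed.

Lemma W1_upper_left x : - 88 / 100 <= x <= 0 ->
  2 * n1 x < (45 + 86 * (x ^ 2 * p x) - 11 * (x ^ 2 * p x) ^ 2) * q x ^ 3.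
Proof.
  intros Hx; apply Rlt_0_minus; unfold_polys.
  destruct (Rlt_dec x (- 66 / 100)).
  - poly_pos x (-88)%Z (-66)%Z 100%Z.
  - destruct (Rlt_dec x (- 44 / 100)).
    + poly_pos x (-66)%Z (-44)%Z 100%Z.
    + poly_pos x (-44)%Z 1%Z 100%Z.
Qed.

(** * The linearising coordinate *)

(** Monotonicity of f makes g continuous; then the quotient k / h for g is the
    inverse of the quotient h / k for f with k = g (u + h) - g u -> 0. *)
Lemma is_derive_inverse (f g : R -> R) (a b c d : R) :
  (forall x y, a < x < y -> y < b -> f x < f y) ->
  (forall u, c < u < d -> a < g u < b /\ f (g u) = u) ->
  forall u l, c < u < d -> 0 < l -> is_derive f (g u) l -> is_derive g u (/ l).
Proof.
  intros Hf Hg u l Hu Hl Hd.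
  set (x := g u) in *.
  destruct (Hg u Hu) as [Hx Hfx]. fold x in Hx, Hfx.
  assert (Hinj : forall y1 y2, a < y1 < b -> a < y2 < b -> f y1 < f y2 -> y1 < y2).
  { intros y1 y2 H1 H2 H. destruct (Rtotal_order y1 y2) as [?|[->|?]]; try lra.
    assert (f y2 < f y1) by (apply Hf; lra). lra. }
  assert (Hcont : forall e, 0 < e -> exists e', 0 < e' /\
    forall h, Rabs h < e' -> c < u + h < d /\ Rabs (g (u + h) - x) < e).
  { intros e He.
    set (e1 := Rmin (e / 2) (Rmin ((x - a) / 2) ((b - x) / 2))).
    assert (He1 : 0 < e1 <= e / 2 /\ a < x - e1 /\ x + e1 < b).
    { unfold e1; pose proof (Rmin_l (e / 2) (Rmin ((x - a) / 2) ((b - x) / 2))).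
      pose proof (Rmin_r (e / 2) (Rmin ((x - a) / 2) ((b - x) / 2))).
      pose proof (Rmin_l ((x - a) / 2) ((b - x) / 2)).
      pose proof (Rmin_r ((x - a) / 2) ((b - x) / 2)).
      split; [split|]; try lra. repeat apply Rmin_glb_lt; lra. }
    assert (f (x - e1) < f x) by (apply Hf; lra).
    assert (f x < f (x + e1)) by (apply Hf; lra).
    exists (Rmin (Rmin (u - f (x - e1)) (f (x + e1) - u)) (Rmin (u - c) (d - u))).
    split; [repeat apply Rmin_glb_lt; lra|].
    intros h Hh.
    apply Rmin_Rgt in Hh as [Hh1 Hh2].
    apply Rmin_Rgt in Hh1 as [Hh1 Hh3]. apply Rmin_Rgt in Hh2 as [Hh2 Hh4].
    apply Rabs_def2 in Hh1, Hh2, Hh3, Hh4.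
    assert (Huh : c < u + h < d) by lra. split; [exact Huh|].
    destruct (Hg _ Huh) as [Hy Hfy].
    assert (x - e1 < g (u + h)) by (apply Hinj; lra).
    assert (g (u + h) < x + e1) by (apply Hinj; lra).
    apply Rabs_def1; lra. }
  apply is_derive_Reals. apply is_derive_Reals in Hd.
  intros eps Heps.
  set (eta := Rmin (l / 2) (eps * l * l / 4)).
  assert (Heta : 0 < eta /\ eta <= l / 2 /\ eta <= eps * l * l / 4).
  { unfold eta; split; [|split; [apply Rmin_l|apply Rmin_r]].
    apply Rmin_glb_lt; [lra|]. assert (0 < eps * l) by nra. nra. }
  destruct (Hd eta ltac:(lra)) as [del Hdel].
  destruct (Hcont del (cond_pos del)) as [e' [He' Hh]].
  exists (mkposreal e' He'); simpl; intros h Hh0 Hhe.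
  destruct (Hh h Hhe) as [Huh Hk].
  destruct (Hg _ Huh) as [Hy Hfy].
  fold x. set (k := g (u + h) - x) in *.
  assert (Hgk : g (u + h) = x + k) by (unfold k; ring).
  assert (Hk0 : k <> 0).
  { intros E. rewrite Hgk, E, Rplus_0_r in Hfy. lra. }
  specialize (Hdel k Hk0 Hk). rewrite <- Hgk, Hfy, Hfx in Hdel.
  replace (u + h - u) with h in Hdel by ring.
  set (m := h / k) in *.
  assert (Hm : l / 2 <= m) by (apply Rabs_def2 in Hdel; lra).
  replace (k / h) with (/ m) by (unfold m; field; lra).
  replace (/ m - / l) with (- (m - l) * / (m * l)) by (field; lra).
  rewrite Rabs_mult, Rabs_Ropp, (Rabs_right (/ (m * l))).
  2:{ apply Rle_ge, Rlt_le, Rinv_0_lt_compat; nra. }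
  apply (Rmult_lt_reg_r (m * l)); [nra|].
  rewrite Rmult_assoc, Rinv_l, Rmult_1_r by nra. nra.
Qed.

Lemma p_pos x : -1 <= x -> 0 < p x.
Proof.
  intros Hx; unfold p.
  (* 11/20 approximates the local minimum sqrt (5/18) of p; expanding the
     product gives the tangent-like bound p x >= 0.89 x + 11. *)
  assert (0 <= (x - 11 / 20) ^ 2 * (x + 11 / 10))
    by (apply Rmult_le_pos; [apply pow2_ge_0|lra]).
  lra.
Qed.

Lemma q_pos x : -1 < x -> 0 < q x.
Proof.
  intros Hx; unfold q.
  replace (2 * x ^ 3 - x + 1) with ((x + 1) * (x ^ 2 + (x - 1) ^ 2)) by ring.
  apply Rmult_lt_0_compat; [lra|]. pose proof (pow2_ge_0 (x - 1 / 2)). lra.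
Qed.

Definition U x := x * sqrt (p x / 30).

(** The circle of radius [r_s] = - U (-1) is the level of the saddle. *)
Definition r_s := sqrt (13 / 30).

Lemma U_sqr x : -1 <= x -> U x ^ 2 = x ^ 2 * p x / 30.
Proof.
  intros Hx. pose proof (p_pos x Hx).
  unfold U; rewrite Rpow_mult_distr, pow2_sqrt; lra.
Qed.

Lemma is_derive_U x : -1 <= x ->
  is_derive U x (q x / (2 * sqrt (p x / 30))).
Proof.
  intros Hx. pose proof (p_pos x Hx) as Hp.
  assert (0 < sqrt (p x / 30)) by (apply sqrt_lt_R0; lra).
  assert (E : sqrt (p x / 30) * sqrt (p x / 30) = p x / 30) by (apply sqrt_sqrt; lra).
  unfold U, p in *. auto_derive; [lra|].
  set (s := sqrt _) in *.
  replace (sqrt _) with s by (unfold s; f_equal; field).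
  apply (Rmult_eq_reg_r (2 * s)); [|lra]. unfold q. field_simplify; [|lra|lra].
  replace (s ^ 2) with ((12 * x ^ 3 - 10 * x + 15) / 30) by (rewrite <- E; ring).
  field.
Qed.

Lemma U_lt x y : -1 < x -> x < y -> U x < U y.
Proof.
  intros Hx Hxy.
  apply (incr_function U (-1) p_infty (fun x => q x / (2 * sqrt (p x / 30))));
    simpl; auto; intros z Hz _.
  - apply is_derive_U; lra.
  - pose proof (p_pos z (Rlt_le _ _ Hz)).
    apply Rdiv_lt_0_compat; [now apply q_pos|].
    apply Rmult_lt_0_compat; [lra|apply sqrt_lt_R0; lra].
Qed.

Lemma U_continuous : continuity U.
Proof.
  intros x; apply continuity_pt_filterlim.
  apply (continuous_mult (K := R_AbsRing) (fun x : R => x) (fun x => sqrt (p x / 30))).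
  - apply continuous_id.
  - apply (continuous_comp (fun x => p x / 30) sqrt); [|apply continuous_sqrt].
    apply (ex_derive_continuous (fun x => p x / 30)).
    unfold p; auto_derive; auto.
Qed.

Definition X (u : R) : R :=
  epsilon (inhabits 0) (fun x => -1 < x < 1 /\ U x = u).

Lemma r_s_sqr : r_s ^ 2 = 13 / 30.
Proof. apply pow2_sqrt; lra. Qed.

Lemma r_s_pos : 0 < r_s.
Proof. apply sqrt_lt_R0; lra. Qed.

Lemma X_spec u : - r_s < u < r_s -> -1 < X u < 1 /\ U (X u) = u.
Proof.
  intros Hu. apply (epsilon_spec (inhabits 0) (fun x => -1 < x < 1 /\ U x = u)).
  assert (E1 : U (-1) = - r_s).
  { unfold U, r_s, p.
    replace ((12 * (-1) ^ 3 - 10 * -1 + 15) / 30) with (13 / 30) by lra. ring. }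
  assert (E2 : r_s < U 1).
  { unfold U, r_s, p; rewrite Rmult_1_l. apply sqrt_lt_1; lra. }
  destruct (IVT_gen U (-1) 1 u U_continuous) as [x [Hx Ex]].
  - rewrite Rmin_left, Rmax_right; lra.
  - rewrite Rmin_left, Rmax_right in Hx by lra.
    exists x; split; [|exact Ex]. split.
    + destruct (Req_dec x (-1)) as [->|]; lra.
    + destruct (Req_dec x 1) as [->|]; lra.
Qed.

Lemma X_unique x : -1 < x -> - r_s < U x < r_s -> X (U x) = x.
Proof.
  intros Hx Hu. destruct (X_spec _ Hu) as [H E].
  destruct (Rtotal_order (X (U x)) x) as [L|[L|L]]; auto;
    apply U_lt in L; lra.
Qed.

Lemma X_lt u v : - r_s < u -> u < v -> v < r_s -> X u < X v.
Proof.
  intros Hu Huv Hv.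
  destruct (X_spec u) as [H E]; [lra|]. destruct (X_spec v) as [H' E']; [lra|].
  destruct (Rtotal_order (X u) (X v)) as [L|[L|L]]; auto.
  - rewrite L in E; lra.
  - apply U_lt in L; lra.
Qed.

Lemma X_0 : X 0 = 0.
Proof.
  pose proof r_s_pos.
  replace 0 with (U 0) at 1 by (unfold U; ring). apply X_unique; [lra|].
  unfold U; rewrite Rmult_0_l; lra.
Qed.

Definition w x := 2 * sqrt (p x / 30) / q x.

Lemma is_derive_X u : - r_s < u < r_s -> is_derive X u (w (X u)).
Proof.
  intros Hu. destruct (X_spec u Hu) as [H E].
  pose proof (p_pos (X u)). pose proof (q_pos (X u)).
  assert (0 < sqrt (p (X u) / 30)) by (apply sqrt_lt_R0; lra).
  replace (w (X u)) with (/ (q (X u) / (2 * sqrt (p (X u) / 30))))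
    by (unfold w; field; split; lra).
  apply (is_derive_inverse U X (-1) 1 (- r_s) r_s); auto.
  - intros x y Hx Hy; apply U_lt; lra.
  - apply X_spec.
  - apply Rdiv_lt_0_compat; lra.
  - apply is_derive_U; lra.
Qed.

(** * Derivatives along the coordinate *)

(** [W1] and [W2] are the first two derivatives of w^2.  As X' = w (X), they
    give X'' = W1 (X) / 2, X''' = W2 (X) w (X) / 2, and the fourth derivative
    of X is V (X).  Finally [nu] is a primitive of x q x V x / 2, that is,
    of u V (X u) in the variable u. *)
Definition W1 x := 2 / 15 * (n1 x / q x ^ 3).
Definition W2 x := 2 / 15 * (n2 x / q x ^ 4).
Definition nu x := / 225 * (nu_num x / q x ^ 5).
Definition V x := / 225 * (V_num x / q x ^ 7).

Lemma is_derive_div_q (c : R) (n : R -> R) (dn : R) (k : nat) (x : R) :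
  -1 < x -> is_derive n x dn ->
  is_derive (fun x => c * (n x / q x ^ k)) x
    (c * ((dn * q x - INR k * n x * (6 * x ^ 2 - 1)) / q x ^ S k)).
Proof.
  intros Hx Hn. pose proof (q_pos x Hx) as Hq.
  assert (is_derive q x (6 * x ^ 2 - 1)) as Hdq.
  { unfold q; auto_derive; auto; ring. }
  assert (Hk : q x ^ k <> 0) by (apply pow_nonzero; lra).
  evar_last.
  { apply is_derive_scal, is_derive_div; [exact Hn| |exact Hk].
    apply is_derive_pow, Hdq. }
  destruct k as [|k]; simpl pow; simpl pred.
  - simpl; field; lra.
  - simpl in Hk. field. split; [apply pow_nonzero; lra|lra].
Qed.

Lemma is_derive_W1 x : -1 < x -> is_derive W1 x (W2 x).
Proof.
  intros Hx. unfold W1, W2.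
  replace (n2 x) with ((-360 * x ^ 4 + 264 * x ^ 2 - 288 * x - 10) * q x
     - INR 3 * n1 x * (6 * x ^ 2 - 1)) by (unfold n2, n1, q; simpl; ring).
  apply (is_derive_div_q (2 / 15) n1 _ 3); auto.
  unfold n1; auto_derive; auto; ring.
Qed.

Lemma is_derive_W2 x : -1 < x -> is_derive W2 x (2 / 15 * (n3 x / q x ^ 5)).
Proof.
  intros Hx. unfold W2.
  replace (n3 x) with
    ((4032 * x ^ 6 - 4560 * x ^ 4 + 6624 * x ^ 3 + 480 * x ^ 2 - 480 * x - 308) * q x
     - INR 4 * n2 x * (6 * x ^ 2 - 1)) by (unfold n3, n2, q; simpl; ring).
  apply (is_derive_div_q (2 / 15) n2 _ 4); auto.
  unfold n2; auto_derive; auto; ring.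
Qed.

Lemma w_pos x : -1 < x -> 0 < w x.
Proof.
  intros Hx. pose proof (p_pos x). pose proof (q_pos x).
  apply Rdiv_lt_0_compat; [|auto].
  apply Rmult_lt_0_compat; [lra|apply sqrt_lt_R0; lra].
Qed.

Lemma w_sqr x : -1 < x -> w x ^ 2 = 2 / 15 * (p x / q x ^ 2).
Proof.
  intros Hx. pose proof (p_pos x). pose proof (q_pos x).
  unfold w, Rdiv. rewrite !Rpow_mult_distr.
  rewrite pow2_sqrt by (unfold Rdiv in *; lra). field; lra.
Qed.

Lemma is_derive_w x : -1 < x -> is_derive w x (W1 x / (2 * w x)).
Proof.
  intros Hx. pose proof (p_pos x ltac:(lra)) as Hp. pose proof (q_pos x Hx) as Hq.
  pose proof (w_pos x Hx) as Hw. pose proof (w_sqr x Hx) as Hw2.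
  assert (Hdq : is_derive q x (6 * x ^ 2 - 1)) by (unfold q; auto_derive; auto; ring).
  assert (Hdp : is_derive p x (36 * x ^ 2 - 10)) by (unfold p; auto_derive; auto; ring).
  assert (Hs : 0 < sqrt (p x / 30)) by (apply sqrt_lt_R0; lra).
  assert (Es : sqrt (p x / 30) ^ 2 = p x / 30) by (apply pow2_sqrt; lra).
  evar_last.
  { apply (is_derive_div (fun x => 2 * sqrt (p x / 30)) q); [|exact Hdq|lra].
    apply is_derive_scal, is_derive_sqrt; [|lra].
    apply (is_derive_scal_l (V := R_NormedModule) p), Hdp. }
  unfold W1, w, scal; simpl; unfold mult; simpl.
  set (s := sqrt (p x / 30)) in *.
  replace (n1 x) with ((36 * x ^ 2 - 10) * q x - 60 * s ^ 2 * (6 * x ^ 2 - 1)).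
  - field; split; lra.
  - rewrite Es; unfold n1, p, q; field.
Qed.

(** The factor x q x / 2 is what turns d/dx into d/du with the weight u:
    see [X_w]. *)
Lemma is_derive_nu x : -1 < x -> is_derive nu x (x * q x / 2 * V x).
Proof.
  intros Hx. pose proof (q_pos x Hx) as Hq. unfold nu, V.
  assert (Hd : is_derive nu_num x (
     (p x + x * (36 * x ^ 2 - 10)) * n2 x
     + x * p x * (4032 * x ^ 6 - 4560 * x ^ 4 + 6624 * x ^ 3 + 480 * x ^ 2 - 480 * x - 308)
     - 15 * (-360 * x ^ 4 + 264 * x ^ 2 - 288 * x - 10) * q x ^ 2
     - 30 * n1 x * q x * (6 * x ^ 2 - 1))).
  { unfold nu_num, n1, n2, p, q; auto_derive; auto; ring. }
  pose proof (is_derive_div_q (/ 225) nu_num _ 5 x Hx Hd) as H.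
  evar_last; [exact H|].
  replace (x * q x / 2 * (/ 225 * (V_num x / q x ^ 7)))
    with (/ 225 * (x * V_num x / 2 / q x ^ 6)) by (field; lra).
  do 2 f_equal. unfold nu_num, V_num, n3, n2, n1, p, q; simpl; field.
Qed.

Lemma ex_derive_V x : -1 < x -> ex_derive V x.
Proof.
  intros Hx; pose proof (q_pos x Hx) as Hq. unfold V.
  assert (ex_derive V_num x) as [d Hd]
    by (unfold V_num, n3, n2, n1, p, q; auto_derive; auto).
  eexists; exact (is_derive_div_q (/ 225) V_num d 7 x Hx Hd).
Qed.

(** [e1] and [e2] are the derivatives of [e0]; [m0] equals u e2 - e1, and [m1]
    is its derivative. *)
Definition e0 u := w (X u) + w (X (- u)).
Definition e1 u := (W1 (X u) - W1 (X (- u))) / 2.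
Definition e2 u := (W2 (X u) * w (X u) + W2 (X (- u)) * w (X (- u))) / 2.
Definition m0 u := nu (X u) - nu (X (- u)).
Definition m1 u := u * (V (X u) - V (X (- u))).

(** Used with c = 1, -1: an even combination has an odd derivative and vice
    versa. *)
Lemma is_derive_comp_X (F : R -> R) (dF : R -> R) (c u : R) :
  (forall x, -1 < x -> is_derive F x (dF x)) -> - r_s < u < r_s ->
  is_derive (fun u => F (X u) + c * F (X (- u))) u
    (dF (X u) * w (X u) - c * (dF (X (- u)) * w (X (- u)))).
Proof.
  intros HF Hu.
  assert (Hu' : - r_s < - u < r_s) by lra.
  pose proof (is_derive_X u Hu) as H1. pose proof (is_derive_X (- u) Hu') as H2.
  destruct (X_spec u Hu) as [Hx _]. destruct (X_spec _ Hu') as [Hz _].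
  pose proof (HF (X u) ltac:(lra)) as H3. pose proof (HF (X (- u)) ltac:(lra)) as H4.
  evar_last.
  { apply (is_derive_plus (fun u => F (X u)) (fun u => c * F (X (- u)))).
    - apply (is_derive_comp F X); eassumption.
    - apply is_derive_scal, (is_derive_comp (fun y => F (X y)) Ropp).
      + apply (is_derive_comp F X); eassumption.
      + apply is_derive_Reals, derivable_pt_lim_opp, derivable_pt_lim_id. }
  unfold plus, scal, mult; simpl; unfold mult; simpl. ring.
Qed.

Lemma is_derive_e0 u : - r_s < u < r_s -> is_derive e0 u (e1 u).
Proof.
  intros Hu.
  evar_last; [apply (is_derive_ext (fun u => w (X u) + 1 * w (X (- u))))|].
  - intros t; unfold e0; simpl; ring.
  - apply is_derive_comp_X; [apply is_derive_w|exact Hu].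
  - destruct (X_spec u Hu) as [Hx _]. destruct (X_spec (- u) ltac:(lra)) as [Hz _].
    pose proof (w_pos (X u)). pose proof (w_pos (X (- u))).
    unfold e1; field; split; lra.
Qed.

Lemma is_derive_e1 u : - r_s < u < r_s -> is_derive e1 u (e2 u).
Proof.
  intros Hu.
  evar_last; [apply (is_derive_ext (fun u => / 2 * (W1 (X u) + -1 * W1 (X (- u)))))|].
  - intros t; unfold e1; simpl; field.
  - apply is_derive_scal, is_derive_comp_X; [apply is_derive_W1|exact Hu].
  - unfold e2; field.
Qed.

Lemma X_w u : - r_s < u < r_s -> X u * q (X u) / 2 * w (X u) = u.
Proof.
  intros Hu. destruct (X_spec u Hu) as [Hx E]. rewrite <- E at 4.
  pose proof (q_pos (X u)). unfold U, w; field; lra.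
Qed.

Lemma is_derive_m0 u : - r_s < u < r_s -> is_derive m0 u (m1 u).
Proof.
  intros Hu.
  evar_last; [apply (is_derive_ext (fun u => nu (X u) + -1 * nu (X (- u))))|].
  - intros t; unfold m0; simpl; ring.
  - apply is_derive_comp_X; [apply is_derive_nu|exact Hu].
  - pose proof (X_w u Hu) as H1. pose proof (X_w (- u) ltac:(lra)) as H2.
    transitivity (V (X u) * (X u * q (X u) / 2 * w (X u))
      + V (X (- u)) * (X (- u) * q (X (- u)) / 2 * w (X (- u)))); [ring|].
    rewrite H1, H2; unfold m1; ring.
Qed.

(** X w can be expressed by u through [X_w], so that the product u X''' is
    rational in X although X''' is not. *)
Lemma m0_eq u : - r_s < u < r_s -> m0 u = u * e2 u - e1 u.
Proof.
  intros Hu.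
  assert (K : forall v, - r_s < v < r_s ->
     nu (X v) = (W2 (X v) * (v * w (X v)) - W1 (X v)) / 2).
  { intros v Hv. destruct (X_spec v Hv) as [Hx _]. pose proof (q_pos (X v)).
    replace (v * w (X v)) with (X v * q (X v) / 2 * w (X v) ^ 2).
    2:{ transitivity (X v * q (X v) / 2 * w (X v) * w (X v)); [ring|].
        now rewrite X_w. }
    rewrite w_sqr by lra. unfold nu, W1, W2, nu_num. field; lra. }
  unfold m0, e1, e2. rewrite (K u Hu), (K (- u)) by lra. field.
Qed.

Lemma continuous_comp_X (F : R -> R) u :
  (forall x, -1 < x -> continuous F x) -> - r_s < u < r_s ->
  continuous (fun u => F (X u)) u.
Proof.
  intros HF Hu. apply (continuous_comp X F).
  - apply (ex_derive_continuous X). eexists; now apply is_derive_X.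
  - apply HF. destruct (X_spec u Hu); lra.
Qed.

Lemma continuous_comp_X_opp (F : R -> R) u :
  (forall x, -1 < x -> continuous F x) -> - r_s < u < r_s ->
  continuous (fun u => F (X (- u))) u.
Proof.
  intros HF Hu. apply (continuous_comp Ropp (fun u => F (X u))).
  - apply (continuous_opp (V := R_NormedModule) (fun u : R => u)), continuous_id.
  - apply continuous_comp_X; [exact HF|lra].
Qed.

Lemma continuous_w x : -1 < x -> continuous w x.
Proof.
  intros Hx; apply (ex_derive_continuous w); eexists; now apply is_derive_w.
Qed.

Lemma continuous_e2 u : - r_s < u < r_s -> continuous e2 u.
Proof.
  intros Hu.
  assert (HF : forall x, -1 < x -> continuous (fun x => W2 x * w x) x).
  { intros x Hx. apply (continuous_mult (K := R_AbsRing) W2 w).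
    - apply (ex_derive_continuous W2); eexists; now apply is_derive_W2.
    - now apply continuous_w. }
  apply (continuous_mult (K := R_AbsRing) _ (fun _ => / 2)); [|apply continuous_const].
  apply (continuous_plus (V := R_NormedModule)).
  - now apply (continuous_comp_X (fun x => W2 x * w x)).
  - now apply (continuous_comp_X_opp (fun x => W2 x * w x)).
Qed.

Lemma continuous_m1 u : - r_s < u < r_s -> continuous m1 u.
Proof.
  intros Hu.
  assert (HF : forall x, -1 < x -> continuous V x)
    by (intros; apply (ex_derive_continuous V); now apply ex_derive_V).
  apply (continuous_mult (K := R_AbsRing) (fun u : R => u)); [apply continuous_id|].
  apply (continuous_minus (V := R_NormedModule)).
  - now apply continuous_comp_X.
  - now apply (continuous_comp_X_opp V).
Qed.

(** * Signs along an involution pair *)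

(** G increases to the right of 0 and decreases between the saddle and 0. *)
Lemma level_lt_right x y : 0 <= x -> x < y -> x ^ 2 * p x < y ^ 2 * p y.
Proof.
  intros Hx Hxy. pose proof (U_lt x y ltac:(lra) Hxy) as H.
  assert (0 <= U x) by (apply Rmult_le_pos; [exact Hx|apply sqrt_pos]).
  pose proof (U_sqr x ltac:(lra)). pose proof (U_sqr y ltac:(lra)). nra.
Qed.

Lemma level_lt_left x y : -1 < x -> x < y -> y <= 0 -> y ^ 2 * p y < x ^ 2 * p x.
Proof.
  intros Hx Hxy Hy. pose proof (U_lt x y Hx Hxy) as H.
  assert (U y <= 0).
  { unfold U; pose proof (sqrt_pos (p y / 30)); nra. }
  pose proof (U_sqr x ltac:(lra)). pose proof (U_sqr y ltac:(lra)). nra.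
Qed.

Lemma X_level u : - r_s < u < r_s -> X u ^ 2 * p (X u) = 30 * u ^ 2.
Proof.
  intros Hu. destruct (X_spec u Hu) as [H E].
  pose proof (U_sqr (X u) ltac:(lra)) as H2. rewrite E in H2. lra.
Qed.

Lemma X_pos u : 0 < u < r_s -> 0 < X u < 1.
Proof.
  intros Hu. pose proof (X_lt 0 u). rewrite X_0 in *.
  destruct (X_spec u); lra.
Qed.

Lemma X_neg u : - r_s < u < 0 -> -1 < X u < 0.
Proof.
  intros Hu. pose proof (X_lt u 0). rewrite X_0 in *.
  destruct (X_spec u); lra.
Qed.

(** A bound on one abscissa of a level gives a bound on the other one, by
    comparing the values of G at the two bounds. *)
Lemma X_opp_gt a b u : 0 < u < r_s -> -1 < b <= 0 ->
  X u <= a -> a ^ 2 * p a < b ^ 2 * p b -> b < X (- u).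
Proof.
  intros Hu Hb Ha Hab. destruct (Rlt_le_dec b (X (- u))) as [?|H]; [assumption|].
  pose proof (X_pos u Hu). pose proof (X_neg (- u) ltac:(lra)).
  pose proof (X_level u ltac:(lra)). pose proof (X_level (- u) ltac:(lra)).
  assert (X u ^ 2 * p (X u) <= a ^ 2 * p a)
    by (destruct Ha as [Ha| ->]; [apply Rlt_le, level_lt_right; lra|lra]).
  assert (b ^ 2 * p b <= X (- u) ^ 2 * p (X (- u)))
    by (destruct H as [H| ->]; [apply Rlt_le, level_lt_left; lra|lra]).
  nra.
Qed.

Lemma X_opp_lt a b u : 0 < u < r_s -> 0 <= a -> -1 < b <= 0 ->
  a <= X u -> b ^ 2 * p b < a ^ 2 * p a -> X (- u) < b.
Proof.
  intros Hu H0 Hb Ha Hab. destruct (Rlt_le_dec (X (- u)) b) as [?|H]; [assumption|].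
  pose proof (X_pos u Hu). pose proof (X_neg (- u) ltac:(lra)).
  pose proof (X_level u ltac:(lra)). pose proof (X_level (- u) ltac:(lra)).
  assert (a ^ 2 * p a <= X u ^ 2 * p (X u))
    by (destruct Ha as [Ha| <-]; [apply Rlt_le, level_lt_right; lra|lra]).
  assert (X (- u) ^ 2 * p (X (- u)) <= b ^ 2 * p b)
    by (destruct H as [H| ->]; [apply Rlt_le, level_lt_left; lra|lra]).
  nra.
Qed.

Lemma div_q_lt n k x j : -1 < x -> n < k * q x ^ j -> n / q x ^ j < k.
Proof.
  intros Hx H. assert (0 < q x ^ j) by (apply pow_lt, q_pos, Hx).
  apply (Rmult_lt_reg_r (q x ^ j)); [assumption|].
  unfold Rdiv; rewrite Rmult_assoc, Rinv_l; lra.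
Qed.

Lemma lt_div_q n k x j : -1 < x -> k * q x ^ j < n -> k < n / q x ^ j.
Proof.
  intros Hx H. assert (0 < q x ^ j) by (apply pow_lt, q_pos, Hx).
  apply (Rmult_lt_reg_r (q x ^ j)); [assumption|].
  unfold Rdiv; rewrite Rmult_assoc, Rinv_l; lra.
Qed.

Lemma m0_neg u : 0 < u < r_s -> X u <= 485 / 1000 -> m0 u < 0.
Proof.
  intros Hu Hx. pose proof (X_pos u Hu) as Hp. pose proof (X_neg (- u) ltac:(lra)) as Hn.
  pose proof (X_level u ltac:(lra)) as L1. pose proof (X_level (- u) ltac:(lra)) as L2.
  unfold m0, nu.
  enough (exists k, nu_num (X u) < k * q (X u) ^ 5 /\
                    k * q (X (- u)) ^ 5 < nu_num (X (- u))) as [k [H1 H2]].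
  { apply div_q_lt in H1; [|lra]. apply lt_div_q in H2; [|lra]. lra. }
  destruct (Rle_dec (X u) (16 / 100)) as [Hs|Hs].
  - assert (- 16 / 100 < X (- u))
      by (apply (X_opp_gt (16 / 100)); auto; unfold p; lra).
    (* 225 times the separating value, with x^2 p x = 30 u^2. *)
    exists (- (300 + 112 / 3 * (30 * u ^ 2))).
    pose proof (nu_num_near_0 (X u) ltac:(lra) ltac:(lra)) as H1.
    pose proof (nu_num_near_0 (X (- u)) ltac:(lra) ltac:(lra)) as H2.
    rewrite L1 in H1. rewrite L2 in H2.
    replace ((- u) ^ 2) with (u ^ 2) in H2 by ring.
    split; nra.
  - exists (- 360). split; [apply nu_num_right; lra|].
    apply nu_num_left. split; [|lra].
    apply Rlt_le, (X_opp_gt (485 / 1000)); auto; unfold p; lra.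
Qed.

Lemma m1_pos u : 0 < u < r_s -> 485 / 1000 <= X u -> 0 < m1 u.
Proof.
  intros Hu Hx. pose proof (X_pos u Hu) as Hp. pose proof (X_neg (- u) ltac:(lra)) as Hn.
  unfold m1, V.
  enough (exists k, k * q (X u) ^ 7 < V_num (X u) /\
                    V_num (X (- u)) < k * q (X (- u)) ^ 7) as [k [H1 H2]].
  { apply lt_div_q in H1; [|lra]. apply div_q_lt in H2; [|lra].
    apply Rmult_lt_0_compat; lra. }
  destruct (Rle_dec (X u) (76 / 100)) as [Hs|Hs].
  - exists 0. rewrite !Rmult_0_l. split; [apply V_num_pos; lra|].
    apply V_num_neg. split; [lra|].
    apply Rlt_le, (X_opp_lt (485 / 1000)); auto; unfold p; lra.
  - exists (- 6750). split; [apply V_num_right; lra|].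
    apply V_num_left. split; [lra|].
    apply Rlt_le, (X_opp_lt (76 / 100)); auto; unfold p; lra.
Qed.

Lemma X_le a u : 0 <= a -> 0 < u < r_s -> 30 * u ^ 2 <= a ^ 2 * p a -> X u <= a.
Proof.
  intros Ha Hu H. destruct (Rle_lt_dec (X u) a) as [?|L]; [assumption|].
  apply level_lt_right in L; [|exact Ha]. rewrite X_level in L; lra.
Qed.

Lemma X_opp_ge b u : -1 < b <= 0 -> 0 < u < r_s -> 30 * u ^ 2 <= b ^ 2 * p b ->
  b <= X (- u).
Proof.
  intros Hb Hu H. destruct (Rle_lt_dec b (X (- u))) as [?|L]; [assumption|].
  pose proof (X_neg (- u) ltac:(lra)).
  apply level_lt_left in L; [|lra|lra]. rewrite X_level in L by lra. nra.
Qed.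

Lemma e1_upper u : 0 < u < r_s -> u ^ 2 <= 14 / 100 ->
  e1 u < 185 / 100 - 26 * u ^ 2.
Proof.
  intros Hu H. pose proof (X_pos u Hu) as Hp. pose proof (X_neg (- u) ltac:(lra)) as Hn.
  assert (X u <= 61 / 100) by (apply X_le; auto; unfold p; lra).
  assert (- 49 / 100 <= X (- u)) by (apply X_opp_ge; auto; unfold p; lra).
  pose proof (W1_upper_right (X u) ltac:(lra)) as B1.
  pose proof (W1_lower_left (X (- u)) ltac:(lra)) as B2.
  rewrite X_level in B1, B2 by lra. replace ((- u) ^ 2) with (u ^ 2) in B2 by ring.
  apply div_q_lt in B1; [|lra]. apply lt_div_q in B2; [|lra].
  unfold e1, W1. unfold Rdiv in *. lra.
Qed.

Lemma e1_lower u : 0 < u < r_s -> u ^ 2 <= 4 / 10 ->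
  (-1 - 256 * u ^ 2 + 835 * u ^ 4) / 2 < e1 u.
Proof.
  intros Hu H. pose proof (X_pos u Hu) as Hp. pose proof (X_neg (- u) ltac:(lra)) as Hn.
  assert (X u <= 905 / 1000) by (apply X_le; auto; unfold p; lra).
  assert (- 88 / 100 <= X (- u)) by (apply X_opp_ge; auto; unfold p; lra).
  pose proof (W1_lower_right (X u) ltac:(lra)) as B1.
  pose proof (W1_upper_left (X (- u)) ltac:(lra)) as B2.
  rewrite X_level in B1, B2 by lra. replace ((- u) ^ 2) with (u ^ 2) in B2 by ring.
  apply lt_div_q in B1; [|lra]. apply div_q_lt in B2; [|lra].
  replace (u ^ 4) with ((u ^ 2) ^ 2) by ring.
  unfold e1, W1. unfold Rdiv in *. lra.
Qed.

Lemma e1_0 : e1 0 = 0.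
Proof. unfold e1; rewrite Ropp_0; field. Qed.

Lemma e1_pos_near_0 : exists del, 0 < del < r_s /\ forall u, 0 < u <= del -> 0 < e1 u.
Proof.
  pose proof r_s_pos as Hr.
  pose proof (is_derive_e1 0 ltac:(lra)) as H. apply is_derive_Reals in H.
  assert (Hd : 0 < e2 0).
  { unfold e2; rewrite Ropp_0, X_0. pose proof (w_pos 0 ltac:(lra)).
    replace (W2 0) with (20 / 3) by (unfold W2, n2, q; field). lra. }
  destruct (H (e2 0) Hd) as [e He].
  exists (Rmin (e / 2) (r_s / 2)).
  pose proof (cond_pos e).
  pose proof (Rmin_l (e / 2) (r_s / 2)). pose proof (Rmin_r (e / 2) (r_s / 2)).
  split; [split; [apply Rmin_glb_lt|]; lra|].
  intros u Hu. specialize (He u ltac:(lra)). rewrite Rabs_right in He by lra.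
  specialize (He ltac:(lra)). rewrite Rplus_0_l, e1_0, Rminus_0_r in He.
  apply Rabs_def2 in He.
  replace (e1 u) with (e1 u / u * u) by (field; lra).
  apply Rmult_lt_0_compat; lra.
Qed.

(** * Averages over a quarter of the circle *)

(** Abel-type averages; the power of the cosine counts the derivatives taken in
    r, see [is_derive_quarter]. *)
Definition quarter (k : nat) (f : R -> R) (r : R) : R :=
  RInt (fun t => cos t ^ k * f (r * cos t)) 0 (PI / 2).

Lemma mul_cos_range rho r t : - rho < r < rho -> - rho < r * cos t < rho.
Proof.
  intros Hr.
  assert (Hr' : Rabs r < rho) by (apply Rabs_def1; lra).
  assert (Hc : Rabs (cos t) <= 1) by (apply Rabs_le, COS_bound).
  assert (H : Rabs (r * cos t) < rho)
    by (rewrite Rabs_mult; pose proof (Rabs_pos r); nra).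
  apply Rabs_def2 in H; lra.
Qed.

Lemma continuous_cos_pow k t : continuous (fun t => cos t ^ k) t.
Proof. apply (ex_derive_continuous (fun t => cos t ^ k)). auto_derive; auto. Qed.

Lemma continuous_quarter_integrand k f rho r t :
  (forall u, - rho < u < rho -> continuous f u) -> - rho < r < rho ->
  continuous (fun t => cos t ^ k * f (r * cos t)) t.
Proof.
  intros Hf Hr.
  apply (continuous_mult (K := R_AbsRing) (fun t => cos t ^ k)).
  - apply continuous_cos_pow.
  - apply (continuous_comp (fun t => r * cos t) f).
    + apply (ex_derive_continuous (fun t => r * cos t)). auto_derive; auto.
    + apply Hf, mul_cos_range, Hr.
Qed.

Lemma ex_RInt_quarter k f rho r a b :
  (forall u, - rho < u < rho -> continuous f u) -> - rho < r < rho ->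
  ex_RInt (fun t => cos t ^ k * f (r * cos t)) a b.
Proof.
  intros Hf Hr. apply (ex_RInt_continuous (V := R_CompleteNormedModule)).
  intros t _. now apply (continuous_quarter_integrand k f rho).
Qed.

Lemma locally_open_interval a b x : a < x < b -> locally x (fun y => a < y < b).
Proof.
  intros H. apply (filter_and (F := locally x)).
  - apply (open_gt a x); lra.
  - apply (open_lt b x); lra.
Qed.

Lemma is_derive_quarter k f df rho r :
  (forall u, - rho < u < rho -> is_derive f u (df u)) ->
  (forall u, - rho < u < rho -> continuous df u) -> - rho < r < rho ->
  is_derive (quarter k f) r (quarter (S k) df r).
Proof.
  intros Hf Hdf Hr.
  assert (HD : forall t u, - rho < u < rho ->
    is_derive (fun u => cos t ^ k * f (u * cos t)) u (cos t ^ S k * df (u * cos t))).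
  { intros t u Hu. evar_last.
    - apply is_derive_scal, (is_derive_comp f (fun u => u * cos t)).
      + apply Hf, mul_cos_range, Hu.
      + apply (is_derive_scal_l (V := R_NormedModule) (fun u : R => u)), is_derive_id.
    - unfold scal; simpl; unfold mult; simpl; unfold one; simpl; ring. }
  assert (Hloc : locally r (fun u => - rho < u < rho)) by (now apply locally_open_interval).
  evar_last.
  - apply (is_derive_RInt_param (fun u t => cos t ^ k * f (u * cos t))).
    + apply (filter_imp (fun u => - rho < u < rho)); [|exact Hloc].
      intros u Hu t _. eexists; now apply HD.
    + intros t _.
      apply (continuity_2d_pt_ext_loc (fun u v => cos v ^ S k * df (u * cos v))).
      * apply locally_2d_locally.
        apply (filter_imp (fun z : R * R => - rho < fst z < rho)).
        -- intros z Hz. symmetry; apply is_derive_unique; now apply HD.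
        -- apply (continuous_fst (U := R_UniformSpace) (V := R_UniformSpace) r t
             (fun u => - rho < u < rho)), Hloc.
      * apply continuity_2d_pt_filterlim.
        change (continuous (T := prod_UniformSpace R_UniformSpace R_UniformSpace) (U := R_UniformSpace)
          (fun z => mult (cos (snd z) ^ S k : R_AbsRing) (df (fst z * cos (snd z)))) (r, t)).
        apply (continuous_mult (K := R_AbsRing)
          (U := prod_UniformSpace R_UniformSpace R_UniformSpace)
          (fun z => cos (snd z) ^ S k) (fun z => df (fst z * cos (snd z)))).
        -- apply (continuous_comp snd (fun t => cos t ^ S k)).
           ++ apply continuous_snd.
           ++ apply continuous_cos_pow.
        -- apply (continuous_comp (fun z : R * R => fst z * cos (snd z)) df).
           ++ apply (continuous_mult (K := R_AbsRing)
               (U := prod_UniformSpace R_UniformSpace R_UniformSpace)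
               fst (fun z => cos (snd z))).
              ** apply continuous_fst.
              ** apply (continuous_comp snd cos); [apply continuous_snd|apply continuous_cos].
           ++ apply Hdf, mul_cos_range, Hr.
    + apply (filter_imp (fun u => - rho < u < rho)); [|exact Hloc].
      intros u Hu. apply (ex_RInt_quarter k f rho); auto.
      intros v Hv. apply (ex_derive_continuous f); eexists; now apply Hf.
  - unfold quarter. apply RInt_ext. intros t _. apply is_derive_unique. now apply HD.
Qed.

Lemma RInt_cos_even_poly c0 c1 c2 :
  RInt (fun t => cos t * (c0 + c1 * cos t ^ 2 + c2 * cos t ^ 4)) 0 (PI / 2)
  = c0 + 2 / 3 * c1 + 8 / 15 * c2.
Proof.
  apply is_RInt_unique.
  set (F := fun t => c0 * sin t + c1 * (sin t - sin t ^ 3 / 3)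
                     + c2 * (sin t - 2 / 3 * sin t ^ 3 + sin t ^ 5 / 5)).
  evar_last.
  - apply (is_RInt_derive (V := R_CompleteNormedModule) F).
    + intros t _. unfold F. auto_derive; [auto|].
      assert (E : cos t ^ 2 = 1 - sin t ^ 2)
        by (pose proof (sin2_cos2 t); unfold Rsqr in *; lra).
      replace (cos t ^ 4) with ((cos t ^ 2) ^ 2) by ring. rewrite E. field.
    + intros t _.
      apply (ex_derive_continuous (fun t => cos t * (c0 + c1 * cos t ^ 2 + c2 * cos t ^ 4))).
      auto_derive; auto.
  - unfold minus, plus, opp, F; simpl. rewrite sin_PI2, sin_0. field.
Qed.

Lemma cos_in_0_1 t : 0 < t < PI / 2 -> 0 < cos t < 1.
Proof.
  intros Ht. split; [apply cos_gt_0; lra|].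
  rewrite <- cos_0. apply cos_decreasing_1; pose proof PI_RGT_0; lra.
Qed.

Lemma continuous_of_derive (f df : R -> R) u :
  is_derive f u (df u) -> continuous f u.
Proof. intros H; apply (ex_derive_continuous f); eexists; exact H. Qed.

Lemma continuous_e1 u : - r_s < u < r_s -> continuous e1 u.
Proof. intros; now apply (continuous_of_derive e1 e2), is_derive_e1. Qed.

Lemma continuous_m0 u : - r_s < u < r_s -> continuous m0 u.
Proof. intros; now apply (continuous_of_derive m0 m1), is_derive_m0. Qed.

(** This is r^2 times the derivative of [quarter 1 e1 r / r]. *)
Lemma quarter_m0 r : - r_s < r < r_s ->
  quarter 1 m0 r = r * quarter 2 e2 r - quarter 1 e1 r.
Proof.
  intros Hr. unfold quarter.
  rewrite <- (RInt_scal (V := R_CompleteNormedModule) (fun t => cos t ^ 2 * e2 (r * cos t)))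
    by (apply (ex_RInt_quarter 2 e2 r_s); auto using continuous_e2).
  rewrite <- (RInt_minus (V := R_CompleteNormedModule)).
  - apply RInt_ext. intros t _. rewrite m0_eq by (now apply mul_cos_range).
    unfold minus, plus, opp, scal; simpl; unfold mult; simpl. ring.
  - apply (ex_RInt_scal (V := R_NormedModule)), (ex_RInt_quarter 2 e2 r_s);
      auto using continuous_e2.
  - apply (ex_RInt_quarter 1 e1 r_s); auto using continuous_e1.
Qed.

Lemma quarter_lt k l f g r :
  0 < r < r_s -> (forall u, - r_s < u < r_s -> continuous f u) ->
  (forall u, - r_s < u < r_s -> continuous g u) ->
  (forall u, 0 < u < r -> forall c, 0 < c -> c ^ k * f u < c ^ l * g u) ->
  quarter k f r < quarter l g r.
Proof.
  intros Hr Hf Hg H. pose proof PI_RGT_0. unfold quarter. apply RInt_lt.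
  - lra.
  - intros t _. apply (continuous_quarter_integrand l g r_s); auto; lra.
  - intros t _. apply (continuous_quarter_integrand k f r_s); auto; lra.
  - intros t Ht. pose proof (cos_in_0_1 t Ht). apply H; nra.
Qed.

Lemma quarter_m0_neg r : 0 < r < r_s -> (forall u, 0 < u < r -> m0 u < 0) ->
  quarter 1 m0 r < 0.
Proof.
  intros Hr H.
  replace 0 with (quarter 1 (fun _ => 0) r).
  - apply quarter_lt; auto using continuous_m0.
    + intros; apply continuous_const.
    + intros u Hu c Hc. specialize (H u Hu). nra.
  - unfold quarter. rewrite (RInt_ext _ (fun _ => 0)) by (intros; simpl; ring).
    rewrite RInt_const. unfold scal; simpl; unfold mult; simpl; ring.
Qed.

(** On the part of the quarter where u = r cos t >= a the integrand is positive.
    On the rest the sign of m1 is unknown, but m0 < 0: since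
    - r sin t * m1 (r cos t) is the derivative of m0 (r cos t), integrating by
    parts against cos^2 / (r sin), which decreases in t, leaves an integral of
    - m0 with a positive weight.  The boundary terms vanish because m0 a = 0 at
    one end and cos = 0 at the other. *)
Lemma quarter_m1_pos a r : 0 < a < r -> r < r_s -> m0 a = 0 ->
  (forall u, 0 < u < a -> m0 u < 0) -> (forall u, a <= u < r_s -> 0 < m1 u) ->
  0 < quarter 2 m1 r.
Proof.
  intros Ha Hr H0 Hneg Hpos. unfold quarter. pose proof PI_RGT_0.
  set (ts := acos (a / r)).
  assert (Har : 0 < a / r < 1).
  { split; [apply Rdiv_lt_0_compat; lra|].
    apply (Rmult_lt_reg_r r); [lra|]. unfold Rdiv; rewrite Rmult_assoc, Rinv_l; lra. }
  assert (Ecos : cos ts = a / r) by (apply cos_acos; lra).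
  assert (Hts : 0 < ts < PI / 2).
  { split.
    - destruct (acos_bound (a / r)) as [[L|E] _]; [exact L|].
      fold ts in E. rewrite <- E, cos_0 in Ecos. lra.
    - destruct (Rlt_le_dec ts (PI / 2)) as [L|L]; [exact L|].
      pose proof (acos_bound (a / r)) as B; fold ts in B.
      pose proof (cos_le_0 ts ltac:(lra) ltac:(lra)). lra. }
  assert (Hra : forall t, ts < t < PI / 2 -> 0 < r * cos t < a).
  { intros t Ht. pose proof (cos_in_0_1 t ltac:(lra)).
    assert (cos t < cos ts) by (apply cos_decreasing_1; lra).
    rewrite Ecos in *. split; [nra|].
    replace a with (r * (a / r)) by (field; lra). nra. }
  assert (Hcm : forall t, continuous (fun t => cos t ^ 2 * m1 (r * cos t)) t).
  { intros t. apply (continuous_quarter_integrand 2 m1 r_s); [apply continuous_m1|lra]. }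
  assert (Hex : forall b c, ex_RInt (fun t => cos t ^ 2 * m1 (r * cos t)) b c).
  { intros b c. apply (ex_RInt_quarter 2 m1 r_s); [apply continuous_m1|lra]. }
  rewrite <- (RInt_Chasles (V := R_CompleteNormedModule) _ 0 ts (PI / 2)); auto.
  assert (Hleft : 0 < RInt (fun t => cos t ^ 2 * m1 (r * cos t)) 0 ts).
  { apply RInt_gt_0; [lra| |auto].
    intros t Ht. pose proof (cos_in_0_1 t ltac:(lra)).
    assert (cos ts < cos t) by (apply cos_decreasing_1; lra).
    rewrite Ecos in *.
    assert (a = r * (a / r)) by (field; lra).
    assert (r * (a / r) < r * cos t) by (apply Rmult_lt_compat_l; lra).
    assert (r * cos t < r * 1) by (apply Rmult_lt_compat_l; lra).
    apply Rmult_lt_0_compat; [apply pow_lt; lra|]. apply Hpos; lra. }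
  enough (0 < RInt (fun t => cos t ^ 2 * m1 (r * cos t)) ts (PI / 2))
    by (apply Rplus_lt_0_compat; assumption).
  (* F' = - w0 m0 - cos^2 m1, and F vanishes at both ends. *)
  set (F := fun t => cos t ^ 2 / sin t * m0 (r * cos t) / r).
  set (w0 := fun t => cos t * (1 + sin t ^ 2) / sin t ^ 2 / r).
  set (dF := fun t => - (w0 t * m0 (r * cos t)) - cos t ^ 2 * m1 (r * cos t)).
  assert (Hsin : forall t, ts <= t <= PI / 2 -> 0 < sin t)
    by (intros t Ht; apply sin_gt_0; lra).
  assert (Hw0 : forall t, ts <= t <= PI / 2 -> continuous w0 t).
  { intros t Ht. pose proof (Hsin t Ht). apply (ex_derive_continuous w0).
    unfold w0; auto_derive. repeat split; try lra. rewrite Rmult_1_r.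
    apply Rgt_not_eq; nra. }
  assert (Hwm : forall t, ts <= t <= PI / 2 ->
    continuous (fun t => - (w0 t * m0 (r * cos t))) t).
  { intros t Ht. apply (continuous_opp (V := R_NormedModule)).
    apply (continuous_mult (K := R_AbsRing) w0); [auto|].
    apply (continuous_ext (fun t => cos t ^ 0 * m0 (r * cos t))).
    - intros s; simpl; ring.
    - apply (continuous_quarter_integrand 0 m0 r_s); [apply continuous_m0|lra]. }
  assert (HF : is_RInt dF ts (PI / 2) 0).
  { evar_last.
    - apply (is_RInt_derive (V := R_CompleteNormedModule) F dF);
        rewrite Rmin_left, Rmax_right by lra.
      + intros t Ht. pose proof (Hsin t Ht).
        assert (Hm : is_derive (fun t => m0 (r * cos t)) t (- (r * sin t) * m1 (r * cos t))).
        { apply (is_derive_comp m0 (fun t => r * cos t)).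
          - apply is_derive_m0, mul_cos_range; lra.
          - auto_derive; auto; ring. }
        assert (Hc : is_derive (fun t => cos t ^ 2 / sin t / r) t (- w0 t)).
        { unfold w0; auto_derive; [repeat split; auto; lra|].
          assert (E : cos t ^ 2 = 1 - sin t ^ 2)
            by (pose proof (sin2_cos2 t); unfold Rsqr in *; lra).
          replace (- (cos t * (1 + sin t ^ 2) / sin t ^ 2 / r))
            with (- (cos t * (2 * sin t ^ 2 + cos t ^ 2) / sin t ^ 2 / r))
            by (rewrite E; field; lra).
          field; lra. }
        apply (is_derive_ext (fun t => cos t ^ 2 / sin t / r * m0 (r * cos t))).
        * intros s; unfold F, Rdiv; simpl; ring.
        * evar_last.
          -- apply (is_derive_mult _ _ t _ _ Hc Hm). intros; apply Rmult_comm.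
          -- unfold dF, plus, mult; simpl; unfold mult; simpl. field; lra.
      + intros t Ht. unfold dF.
        apply (continuous_minus (V := R_NormedModule)); auto.
    - unfold F. rewrite Ecos, cos_PI2.
      replace (r * (a / r)) with a by (field; lra). rewrite H0.
      unfold minus, plus, opp; simpl. unfold Rdiv; ring. }
  assert (Hsum : 0 < RInt (fun t => plus (cos t ^ 2 * m1 (r * cos t)) (dF t)) ts (PI / 2)).
  { apply RInt_gt_0; [lra| |].
    - intros t Ht. specialize (Hneg _ (Hra t Ht)). pose proof (Hsin t ltac:(lra)).
      pose proof (cos_in_0_1 t ltac:(lra)).
      assert (0 < w0 t).
      { unfold w0. repeat apply Rdiv_lt_0_compat; try lra; nra. }
      unfold dF, plus; simpl. nra.
    - intros t Ht. apply (continuous_plus (V := R_NormedModule)); [auto|].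
      apply (continuous_minus (V := R_NormedModule)); auto. }
  rewrite (RInt_plus (V := R_CompleteNormedModule)) in Hsum; [|auto|eexists; exact HF].
  rewrite (is_RInt_unique _ _ _ _ HF) in Hsum.
  rewrite (plus_zero_r (G := R_AbelianGroup)) in Hsum. exact Hsum.
Qed.

(** * The sign pattern of the derivative of the period *)

Lemma MVT_derive (f df : R -> R) a b : a < b ->
  (forall x, a <= x <= b -> is_derive f x (df x)) ->
  exists c, a < c < b /\ f b - f a = df c * (b - a).
Proof.
  intros Hab H.
  destruct (MVT_cor2 f df a b Hab) as [c [E Hc]].
  - intros x Hx. apply is_derive_Reals, H, Hx.
  - exists c; auto.
Qed.

Lemma IVT_sign (f : R -> R) a b : a < b ->
  (forall x, a <= x <= b -> continuous f x) -> f a * f b < 0 ->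
  exists c, a < c < b /\ f c = 0.
Proof.
  intros Hab Hc Hf.
  assert (K : forall g : R -> R, (forall x, a <= x <= b -> continuous g x) ->
    g a < 0 -> 0 < g b -> exists c, a < c < b /\ g c = 0).
  { intros g Hg Ha Hb. destruct (IVT_interv g a b) as [c [H1 H2]]; auto.
    - intros x Hx. apply continuity_pt_filterlim, Hg, Hx.
    - exists c; split; auto.
      assert (c <> a) by (intros ->; lra). assert (c <> b) by (intros ->; lra). lra. }
  destruct (Rlt_le_dec (f a) 0).
  - apply K; auto. nra.
  - destruct (K (fun x => - f x)) as [c [H1 H2]].
    + intros x Hx. apply (continuous_opp (V := R_NormedModule)), Hc, Hx.
    + assert (f a <> 0) by (intros E; rewrite E in Hf; lra). lra.
    + nra.
    + exists c; split; auto; lra.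
Qed.

(** If the average of m0 is nonnegative at r0 then m0 has already vanished at
    some a < r0, and beyond a the average increases. *)
Lemma slope_sign_persists r0 : 0 < r0 < r_s -> 0 <= quarter 1 m0 r0 ->
  forall r, r0 < r < r_s -> 0 < quarter 1 m0 r.
Proof.
  intros Hr0 HM r Hr.
  assert (exists u1, 0 < u1 < r0 /\ 0 <= m0 u1) as [u1 [Hu1 Hm1]].
  { destruct (classic (exists u1, 0 < u1 < r0 /\ 0 <= m0 u1)) as [H|H]; auto.
    exfalso. pose proof (quarter_m0_neg r0 Hr0) as K.
    enough (quarter 1 m0 r0 < 0) by lra. apply K. intros u Hu.
    apply Rnot_le_lt. intros L. apply H; exists u; auto. }
  set (ub := U (485 / 1000)).
  assert (Hub : X u1 <= 485 / 1000 -> False).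
  { intros L. pose proof (m0_neg u1 ltac:(lra) L). lra. }
  assert (Eu1 : U (X u1) = u1) by (apply X_spec; lra).
  assert (Hubu : ub < u1).
  { rewrite <- Eu1. apply U_lt; [lra|]. apply Rnot_le_lt; auto. }
  assert (Hub0 : 0 < ub).
  { replace 0 with (U 0) by (unfold U; ring). apply U_lt; lra. }
  assert (EX : X ub = 485 / 1000) by (apply X_unique; fold ub; lra).
  assert (HXge : forall u, ub <= u < r_s -> 485 / 1000 <= X u).
  { intros u [[L| <-] Hu]; [|lra]. rewrite <- EX. apply Rlt_le, X_lt; lra. }
  assert (Hm1pos : forall u, ub <= u < r_s -> 0 < m1 u).
  { intros u Hu. apply m1_pos; [lra|auto]. }
  assert (Hinc : forall u v, ub <= u -> u < v -> v < r_s -> m0 u < m0 v).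
  { intros u v Hu Huv Hv. destruct (MVT_derive m0 m1 u v Huv) as [c [Hc E]].
    - intros x Hx; apply is_derive_m0; lra.
    - pose proof (Hm1pos c ltac:(lra)). nra. }
  assert (Hmub : m0 ub < 0) by (apply m0_neg; lra).
  assert (exists a, ub < a <= u1 /\ m0 a = 0) as [a [Ha Ha0]].
  { destruct Hm1 as [L|E]; [|exists u1; split; [lra|auto]].
    destruct (IVT_sign m0 ub u1 Hubu) as [a [Ha Ha0]].
    - intros x Hx; apply continuous_m0; lra.
    - nra.
    - exists a; split; [lra|auto]. }
  assert (Hneg : forall u, 0 < u < a -> m0 u < 0).
  { intros u Hu. destruct (Rle_lt_dec (X u) (485 / 1000)) as [L|L].
    - apply m0_neg; lra.
    - rewrite <- Ha0. apply Hinc; try lra.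
      destruct (Rle_lt_dec ub u) as [|L']; [auto|].
      assert (X u < X ub) by (apply X_lt; lra). lra. }
  destruct (MVT_derive (quarter 1 m0) (quarter 2 m1) r0 r) as [c [Hc E]]; [lra| |].
  - intros x Hx. apply (is_derive_quarter 1 m0 m1 r_s); [apply is_derive_m0|apply continuous_m1|lra].
  - assert (0 < quarter 2 m1 c).
    { apply (quarter_m1_pos a); auto; try lra. intros u Hu; apply Hm1pos; lra. }
    nra.
Qed.

(** The hypothesis on df makes f quasi-convex: if f a <= f b for some a < b,
    then f increases strictly after b. *)
Lemma two_sign_changes (f df : R -> R) (R0 p1 p2 p3 : R) :
  0 < p1 < p2 -> p2 < p3 < R0 ->
  (forall r, 0 < r < R0 -> is_derive f r (df r)) ->
  (forall r0, 0 < r0 < R0 -> 0 <= df r0 -> forall r, r0 < r < R0 -> 0 < df r) ->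
  0 < f p1 -> f p2 < 0 -> 0 < f p3 ->
  exists z1 z2, 0 < z1 < z2 /\ z2 < R0 /\
    (forall r, 0 < r < z1 -> 0 < f r) /\
    (forall r, z1 < r < z2 -> f r < 0) /\
    (forall r, z2 < r < R0 -> 0 < f r).
Proof.
  intros Hp1 Hp3 Hd Hpers F1 F2 F3.
  assert (Hc : forall a b, 0 < a -> b < R0 -> forall x, a <= x <= b -> continuous f x).
  { intros a b Ha Hb x Hx. apply (continuous_of_derive f df), Hd; lra. }
  destruct (IVT_sign f p1 p2) as [z1 [Hz1 E1]]; [lra|apply Hc; lra|nra|].
  destruct (IVT_sign f p2 p3) as [z2 [Hz2 E2]]; [lra|apply Hc; lra|nra|].
  assert (Hup : forall a b c, 0 < a -> a < b -> b < c -> c < R0 ->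
    f a <= f b -> f b < f c).
  { intros a b c Ha Hab Hbc Hc0 Hle.
    destruct (MVT_derive f df a b Hab) as [x [Hx Ex]]; [intros; apply Hd; lra|].
    destruct (MVT_derive f df b c Hbc) as [y [Hy Ey]]; [intros; apply Hd; lra|].
    assert (0 <= df x) by (apply Rnot_lt_le; intros L; nra).
    assert (0 < df y) by (apply (Hpers x); lra). nra. }
  exists z1, z2. repeat split; try lra.
  - intros r Hr. apply Rnot_le_lt; intros L.
    pose proof (Hup r z1 z2). lra.
  - intros r Hr. apply Rnot_le_lt; intros L.
    pose proof (Hup z1 r z2). lra.
  - intros r Hr. pose proof (Hup p2 z2 r). lra.
Qed.

Definition period (h : R) : R := 2 * quarter 0 e0 (sqrt (2 * h)).

Lemma is_derive_quarter_e0 r : - r_s < r < r_s ->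
  is_derive (quarter 0 e0) r (quarter 1 e1 r).
Proof.
  intros Hr; apply (is_derive_quarter 0 e0 e1 r_s); auto using is_derive_e0, continuous_e1.
Qed.

Lemma is_derive_quarter_e1 r : - r_s < r < r_s ->
  is_derive (quarter 1 e1) r (quarter 2 e2 r).
Proof.
  intros Hr; apply (is_derive_quarter 1 e1 e2 r_s); auto using is_derive_e1, continuous_e2.
Qed.

Lemma quarter_even_poly c0 c1 c2 r :
  quarter 1 (fun u => c0 + c1 * u ^ 2 + c2 * u ^ 4) r
  = c0 + 2 / 3 * (c1 * r ^ 2) + 8 / 15 * (c2 * r ^ 4).
Proof.
  rewrite <- RInt_cos_even_poly. unfold quarter. apply RInt_ext.
  intros t _. simpl; ring.
Qed.

Lemma continuous_even_poly c0 c1 c2 u :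
  continuous (fun u => c0 + c1 * u ^ 2 + c2 * u ^ 4) u.
Proof.
  apply (ex_derive_continuous (fun u => c0 + c1 * u ^ 2 + c2 * u ^ 4)). auto_derive; auto.
Qed.

(** The polynomial bounds on e1 are averaged exactly by [RInt_cos_even_poly].
    At u^2 = 0.14 the bound is 1.85 - 26 * 0.14 * 2/3 < 0, at u^2 = 0.4 it is
    (- 1 - 256 * 0.4 * 2/3 + 835 * 0.16 * 8/15) / 2 > 0. *)
Lemma quarter_e1_signs : exists p1 p2 p3,
  0 < p1 < p2 /\ p2 < p3 < r_s /\
  0 < quarter 1 e1 p1 /\ quarter 1 e1 p2 < 0 /\ 0 < quarter 1 e1 p3.
Proof.
  pose proof r_s_pos as Hrs. pose proof r_s_sqr as Hrs2.
  destruct e1_pos_near_0 as [del [Hdel H1]].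
  set (p2 := sqrt (14 / 100)). set (p3 := sqrt (4 / 10)).
  assert (E2 : p2 ^ 2 = 14 / 100) by (apply pow2_sqrt; lra).
  assert (E3 : p3 ^ 2 = 4 / 10) by (apply pow2_sqrt; lra).
  assert (H2 : 0 < p2) by (apply sqrt_lt_R0; lra).
  assert (H23 : p2 < p3) by (apply sqrt_lt_1; lra).
  assert (H3 : p3 < r_s) by (apply sqrt_lt_1; lra).
  exists (Rmin del (p2 / 2)), p2, p3.
  pose proof (Rmin_l del (p2 / 2)). pose proof (Rmin_r del (p2 / 2)).
  assert (0 < Rmin del (p2 / 2)) by (apply Rmin_glb_lt; lra).
  repeat split; try lra.
  - set (p1 := Rmin del (p2 / 2)) in *.
    replace 0 with (quarter 1 (fun u => 0 + 0 * u ^ 2 + 0 * u ^ 4) p1)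
      by (rewrite quarter_even_poly; ring).
    apply quarter_lt; auto using continuous_e1, continuous_even_poly; [lra|].
    intros u Hu c Hc. pose proof (H1 u ltac:(lra)). nra.
  - apply Rlt_le_trans with
      (quarter 1 (fun u => 185 / 100 + (- 26) * u ^ 2 + 0 * u ^ 4) p2).
    + apply quarter_lt; auto using continuous_e1, continuous_even_poly; [lra|].
      intros u Hu c Hc. pose proof (e1_upper u ltac:(lra) ltac:(nra)). nra.
    + rewrite quarter_even_poly, E2. lra.
  - apply Rle_lt_trans with
      (quarter 1 (fun u => - 1 / 2 + (- 128) * u ^ 2 + (835 / 2) * u ^ 4) p3).
    + rewrite quarter_even_poly. replace (p3 ^ 4) with ((p3 ^ 2) ^ 2) by ring.
      rewrite E3. lra.
    + apply quarter_lt; auto using continuous_e1, continuous_even_poly; [lra|].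
      intros u Hu c Hc. pose proof (e1_lower u ltac:(lra) ltac:(nra)). nra.
Qed.

Lemma quarter_e1_sign_pattern : exists z1 z2, 0 < z1 < z2 /\ z2 < r_s /\
  (forall r, 0 < r < z1 -> 0 < quarter 1 e1 r) /\
  (forall r, z1 < r < z2 -> quarter 1 e1 r < 0) /\
  (forall r, z2 < r < r_s -> 0 < quarter 1 e1 r).
Proof.
  destruct quarter_e1_signs as (p1 & p2 & p3 & H12 & H23 & S1 & S2 & S3).
  destruct (two_sign_changes (fun r => quarter 1 e1 r / r)
    (fun r => quarter 1 m0 r / r ^ 2) r_s p1 p2 p3) as (z1 & z2 & Hz & Hz2 & P1 & P2 & P3); auto.
  - intros r Hr. rewrite quarter_m0 by lra. evar_last.
    + apply is_derive_div; [apply is_derive_quarter_e1; lra|apply is_derive_id|lra].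
    + unfold one; simpl. field; lra.
  - intros r0 Hr0 L r Hr. apply Rdiv_lt_0_compat; [|apply pow_lt; lra].
    apply (slope_sign_persists r0); auto.
    replace (quarter 1 m0 r0) with (quarter 1 m0 r0 / r0 ^ 2 * r0 ^ 2) by (field; lra).
    apply Rmult_le_pos; [exact L|]. apply pow2_ge_0.
  - apply Rdiv_lt_0_compat; lra.
  - apply Ropp_lt_cancel. rewrite Ropp_0.
    replace (- (quarter 1 e1 p2 / p2)) with (- quarter 1 e1 p2 / p2) by (field; lra).
    apply Rdiv_lt_0_compat; lra.
  - apply Rdiv_lt_0_compat; lra.
  - assert (E : forall r, 0 < r -> quarter 1 e1 r = quarter 1 e1 r / r * r)
      by (intros; field; lra).
    exists z1, z2. repeat split; auto; try lra; intros r Hr; rewrite E by lra.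
    + apply Rmult_lt_0_compat; [auto|lra].
    + pose proof (P2 r Hr). nra.
    + apply Rmult_lt_0_compat; [auto|lra].
Qed.

Lemma period_increment a b : 0 < a < b -> b < 13 / 60 ->
  exists r d, sqrt (2 * a) < r < sqrt (2 * b) /\ 0 < d /\
    period b - period a = quarter 1 e1 r * d.
Proof.
  intros Ha Hb.
  assert (0 < sqrt (2 * a)) by (apply sqrt_lt_R0; lra).
  assert (sqrt (2 * a) < sqrt (2 * b)) by (apply sqrt_lt_1; lra).
  assert (sqrt (2 * b) < r_s) by (apply sqrt_lt_1; lra).
  destruct (MVT_derive (quarter 0 e0) (quarter 1 e1) (sqrt (2 * a)) (sqrt (2 * b)))
    as [r [Hr E]]; auto.
  - intros x Hx; apply is_derive_quarter_e0; lra.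
  - exists r, (2 * (sqrt (2 * b) - sqrt (2 * a))).
    split; [exact Hr|split; [lra|]]. unfold period. lra.
Qed.

Lemma locally_both_sides (P : R -> Prop) x h y : x < h < y -> locally h P ->
  exists s t, x < s < h /\ h < t < y /\ P s /\ P t.
Proof.
  intros Hh [e He]. pose proof (cond_pos e).
  set (e' := Rmin (e / 2) (Rmin ((h - x) / 2) ((y - h) / 2))).
  assert (He' : 0 < e') by (repeat apply Rmin_glb_lt; lra).
  assert (e' <= e / 2) by apply Rmin_l.
  assert (L : e' <= Rmin ((h - x) / 2) ((y - h) / 2)) by apply Rmin_r.
  pose proof (Rmin_l ((h - x) / 2) ((y - h) / 2)).
  pose proof (Rmin_r ((h - x) / 2) ((y - h) / 2)).
  exists (h - e'), (h + e'). repeat split; try lra; apply He; apply Rabs_def1;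
    unfold minus, plus, opp; simpl; lra.
Qed.

Lemma monotone_no_extremum (T : R -> R) x h y : x < h < y ->
  (forall s t, x < s < t -> t < y -> T s < T t) \/
  (forall s t, x < s < t -> t < y -> T t < T s) ->
  ~ (local_max T h \/ local_min T h).
Proof.
  intros Hh Hmono [Hext|Hext];
    destruct (locally_both_sides _ x h y Hh Hext) as (s & t & Hs & Ht & Ps & Pt);
    destruct Hmono as [M|M];
    pose proof (M s h ltac:(lra) ltac:(lra)); pose proof (M h t ltac:(lra) ltac:(lra)); lra.
Qed.

Lemma exactly_two_extrema (T : R -> R) (a h1 h2 b : R) :
  a < h1 < h2 -> h2 < b ->
  (forall x y, a < x < y -> y <= h1 -> T x < T y) ->
  (forall x y, h1 <= x < y -> y <= h2 -> T y < T x) ->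
  (forall x y, h2 <= x < y -> y < b -> T x < T y) ->
  exactly_two (fun h => a < h < b /\ (local_max T h \/ local_min T h)).
Proof.
  intros H1 H2 I1 D I2. exists h1, h2. split; [lra|]. intros h; split.
  - intros [Hh Hext].
    destruct (Rtotal_order h h1) as [L|[E|L]]; [exfalso|auto|].
    { apply (monotone_no_extremum T a h h1); auto; [lra|].
      left; intros; apply I1; lra. }
    destruct (Rtotal_order h h2) as [L'|[E|L']]; [exfalso|auto|exfalso].
    + apply (monotone_no_extremum T h1 h h2); auto.
      right; intros; apply D; lra.
    + apply (monotone_no_extremum T h2 h b); auto; [lra|].
      left; intros; apply I2; lra.
  - intros [->| ->]; (split; [lra|]).
    + left; unfold local_max. apply (filter_imp (fun k => a < k < h2)); [|apply locally_open_interval; lra].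
      intros k Hk. destruct (Rtotal_order k h1) as [L|[->|L]]; [|lra|];
        apply Rlt_le; [apply I1|apply D]; lra.
    + right; unfold local_min. apply (filter_imp (fun k => h1 < k < b)); [|apply locally_open_interval; lra].
      intros k Hk. destruct (Rtotal_order k h2) as [L|[->|L]]; [|lra|];
        apply Rlt_le; [apply D|apply I2]; lra.
Qed.

Lemma period_exactly_two_extrema :
  exactly_two (fun h => 0 < h < 13 / 60 /\ (local_max period h \/ local_min period h)).
Proof.
  destruct quarter_e1_sign_pattern as (z1 & z2 & Hz & Hz2 & P1 & P2 & P3).
  pose proof r_s_sqr as E.
  assert (R1 : sqrt (2 * (z1 ^ 2 / 2)) = z1).
  { replace (2 * (z1 ^ 2 / 2)) with (z1 ^ 2) by field. apply sqrt_pow2; lra. }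
  assert (R2 : sqrt (2 * (z2 ^ 2 / 2)) = z2).
  { replace (2 * (z2 ^ 2 / 2)) with (z2 ^ 2) by field. apply sqrt_pow2; lra. }
  assert (Hz1 : 0 < z1 ^ 2 / 2) by nra.
  assert (Hz12 : z1 ^ 2 / 2 < z2 ^ 2 / 2) by nra.
  assert (Hz2r : z2 ^ 2 / 2 < 13 / 60) by nra.
  assert (Hmono : forall x y, x <= y -> sqrt (2 * x) <= sqrt (2 * y))
    by (intros; apply sqrt_le_1_alt; lra).
  assert (Hpos : forall x, 0 < x -> 0 < sqrt (2 * x))
    by (intros; apply sqrt_lt_R0; lra).
  apply (exactly_two_extrema period 0 (z1 ^ 2 / 2) (z2 ^ 2 / 2)); try lra.
  - intros x y Hx Hy. destruct (period_increment x y) as (r & d & Hr & Hd & Ed); [lra|lra|].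
    pose proof (Hmono _ _ Hy). pose proof (Hpos x).
    pose proof (P1 r ltac:(lra)). nra.
  - intros x y Hx Hy. destruct (period_increment x y) as (r & d & Hr & Hd & Ed); [lra|lra|].
    pose proof (Hmono _ _ Hy). pose proof (Hmono _ x (proj1 Hx)).
    pose proof (P2 r ltac:(lra)). nra.
  - intros x y Hx Hy. destruct (period_increment x y) as (r & d & Hr & Hd & Ed); [lra|lra|].
    pose proof (Hmono _ x (proj1 Hx)).
    assert (sqrt (2 * y) < r_s) by (apply sqrt_lt_1_alt; lra).
    pose proof (P3 r ltac:(lra)). nra.
Qed.

(** * The periodic orbits *)

(** With [G_eq] this is the link between the system and the polynomials [p]
    and [q]. *)
Lemma g_eq x : g (1 / 2) (-1) x = x * q x / 2.
Proof. unfold g, q; field. Qed.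

Lemma G_eq x : G (1 / 2) (-1) x = x ^ 2 * p x / 60.
Proof.
  unfold G. apply is_RInt_unique.
  evar_last.
  - apply (is_RInt_derive (V := R_CompleteNormedModule) (fun x => x ^ 2 * p x / 60)).
    + intros t _. unfold p. auto_derive; [auto|]. unfold g; field.
    + intros t _. apply (ex_derive_continuous (g (1 / 2) (-1))). unfold g; auto_derive; auto.
  - unfold minus, plus, opp; simpl; field.
Qed.

Lemma H_eq x y : H (1 / 2) (-1) (x, y) = y ^ 2 / 2 + x ^ 2 * p x / 60.
Proof. unfold H; simpl fst; simpl snd. rewrite G_eq; reflexivity. Qed.

Lemma h_s_eq : h_s (1 / 2) (-1) = 13 / 60.
Proof. unfold h_s; rewrite G_eq; unfold p; field. Qed.

Lemma sqrt_level h : 0 < h < 13 / 60 ->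
  0 < sqrt (2 * h) < r_s /\ sqrt (2 * h) ^ 2 = 2 * h.
Proof.
  intros Hh. repeat split.
  - apply sqrt_lt_R0; lra.
  - apply sqrt_lt_1; lra.
  - apply pow2_sqrt; lra.
Qed.

(** The angle s of the point (u, y) = (r cos s, r sin s) satisfies
    ds/dt = 1 / X' (r cos s). *)
Definition time_density r s := w (X (r * cos s)).

Definition time_map r th := RInt (time_density r) 0 th.

Lemma time_density_ge r s : 0 < r < r_s -> / 4 <= time_density r s.
Proof.
  intros Hr. pose proof (mul_cos_range r_s r s ltac:(lra)) as Hu.
  destruct (X_spec _ Hu) as [Hx _]. unfold time_density, w.
  set (x := X _) in *. pose proof (q_pos x ltac:(lra)).
  assert (q x <= 4) by (unfold q; nra).
  assert (/ 2 <= sqrt (p x / 30)).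
  { rewrite <- (sqrt_pow2 (/ 2)) by lra. apply sqrt_le_1_alt. unfold p.
    assert (0 <= (x - 11 / 20) ^ 2 * (x + 11 / 10))
      by (apply Rmult_le_pos; [apply pow2_ge_0|lra]). lra. }
  apply (Rmult_le_reg_r (q x)); [assumption|].
  unfold Rdiv; rewrite Rmult_assoc, Rinv_l by lra. lra.
Qed.

Lemma continuous_time_density r s : 0 < r < r_s -> continuous (time_density r) s.
Proof.
  intros Hr.
  apply (continuous_ext (fun s => cos s ^ 0 * w (X (r * cos s)))).
  - intros t; unfold time_density; simpl; ring.
  - apply (continuous_quarter_integrand 0 (fun u => w (X u)) r_s); [|lra].
    intros u Hu; apply (continuous_comp_X w); [apply continuous_w|exact Hu].
Qed.

Lemma ex_RInt_time_density r a b : 0 < r < r_s -> ex_RInt (time_density r) a b.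
Proof.
  intros Hr. apply (ex_RInt_continuous (V := R_CompleteNormedModule)).
  intros; now apply continuous_time_density.
Qed.

Lemma is_derive_time_map r th : 0 < r < r_s ->
  is_derive (time_map r) th (time_density r th).
Proof.
  intros Hr. apply (is_derive_RInt (V := R_NormedModule) (time_density r) (time_map r) 0).
  - apply filter_forall. intros b. apply (RInt_correct (V := R_CompleteNormedModule)).
    now apply ex_RInt_time_density.
  - now apply continuous_time_density.
Qed.

(** The reflections c = 2 PI and c = PI fold the integral over the circle onto
    the first quadrant. *)
Lemma RInt_reflect (f : R -> R) a b c : (forall x, continuous f x) ->
  RInt f a b = RInt (fun s => f (c - s)) (c - b) (c - a).
Proof.
  intros Hf.
  pose proof (RInt_comp_lin f (-1) c (c - b) (c - a)) as K.
  replace (-1 * (c - b) + c) with b in K by ring.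
  replace (-1 * (c - a) + c) with a in K by ring.
  assert (Hex : ex_RInt f b a)
    by (apply (ex_RInt_continuous (V := R_CompleteNormedModule)); auto).
  specialize (K Hex).
  rewrite <- (opp_RInt_swap (V := R_CompleteNormedModule) f) by exact Hex.
  rewrite <- K.
  rewrite (RInt_ext _ (fun y => scal (-1) (f (c - y)))).
  - rewrite (RInt_scal (V := R_CompleteNormedModule)).
    + unfold opp, scal; simpl; unfold mult; simpl. ring.
    + apply (ex_RInt_continuous (V := R_CompleteNormedModule)). intros z _.
      apply (continuous_comp (fun y => c - y) f); [|apply Hf].
      apply (ex_derive_continuous (fun y => c - y)). auto_derive; auto.
  - intros x _. replace (-1 * x + c) with (c - x) by ring. reflexivity.
Qed.

Lemma period_eq_RInt h : 0 < h < 13 / 60 ->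
  period h = time_map (sqrt (2 * h)) (2 * PI).
Proof.
  intros Hh. destruct (sqrt_level h Hh) as [Hr _].
  unfold period, time_map. set (r := sqrt (2 * h)) in *.
  pose proof (continuous_time_density r) as Hc.
  rewrite <- (RInt_Chasles (V := R_CompleteNormedModule) _ 0 PI (2 * PI))
    by (now apply ex_RInt_time_density).
  rewrite (RInt_reflect _ PI (2 * PI) (2 * PI)) by auto.
  replace (2 * PI - 2 * PI) with 0 by ring. replace (2 * PI - PI) with PI by ring.
  rewrite (RInt_ext (fun s => time_density r (2 * PI - s)) (time_density r)).
  2:{ intros s _. unfold time_density. do 3 f_equal.
      rewrite cos_minus, cos_2PI, sin_2PI; ring. }
  assert (E : RInt (time_density r) 0 PI = quarter 0 e0 r).
  { rewrite <- (RInt_Chasles (V := R_CompleteNormedModule) _ 0 (PI / 2) PI)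
      by (now apply ex_RInt_time_density).
    rewrite (RInt_reflect _ (PI / 2) PI PI) by auto.
    replace (PI - PI) with 0 by ring. replace (PI - PI / 2) with (PI / 2) by field.
    rewrite <- (RInt_plus (V := R_CompleteNormedModule)).
    - unfold quarter. apply RInt_ext. intros s _.
      unfold time_density, e0, plus; simpl. rewrite Rmult_1_l. do 4 f_equal.
      rewrite cos_minus, cos_PI, sin_PI; ring.
    - now apply ex_RInt_time_density.
    - apply (ex_RInt_continuous (V := R_CompleteNormedModule)). intros z _.
      apply (continuous_comp (fun y => PI - y) (time_density r)); [|auto].
      apply (ex_derive_continuous (fun y => PI - y)). auto_derive; auto. }
  rewrite E. unfold plus; simpl; ring.
Qed.

Lemma time_map_lt r a b : 0 < r < r_s -> a < b -> time_map r a < time_map r b.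
Proof.
  intros Hr Hab.
  destruct (MVT_derive (time_map r) (time_density r) a b Hab) as [c [_ E]].
  - intros; now apply is_derive_time_map.
  - pose proof (time_density_ge r c Hr). nra.
Qed.

Lemma time_map_0 r : time_map r 0 = 0.
Proof. unfold time_map. apply (RInt_point (V := R_CompleteNormedModule)). Qed.

Lemma time_map_period r th : 0 < r < r_s ->
  time_map r (th + 2 * PI) = time_map r th + time_map r (2 * PI).
Proof.
  intros Hr. unfold time_map at 1.
  rewrite <- (RInt_Chasles (V := R_CompleteNormedModule) _ 0 (2 * PI))
    by (now apply ex_RInt_time_density).
  enough (E : RInt (time_density r) (2 * PI) (th + 2 * PI) = time_map r th).
  { rewrite E. unfold plus; simpl. fold (time_map r (2 * PI)). ring. }
  pose proof (RInt_comp_lin (time_density r) 1 (2 * PI) 0 th) as K.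
  replace (1 * 0 + 2 * PI) with (2 * PI) in K by ring.
  replace (1 * th + 2 * PI) with (th + 2 * PI) in K by ring.
  rewrite <- K by (now apply ex_RInt_time_density).
  apply RInt_ext. intros s _. unfold scal; simpl; unfold mult; simpl.
  rewrite !Rmult_1_l. unfold time_density. do 3 f_equal.
  rewrite cos_plus, cos_2PI, sin_2PI; ring.
Qed.

Lemma time_map_surj r t : 0 < r < r_s -> exists th, time_map r th = t.
Proof.
  intros Hr.
  assert (Hc : continuity (time_map r)).
  { intros x. apply continuity_pt_filterlim.
    apply (continuous_of_derive _ (time_density r)). now apply is_derive_time_map. }
  (* The density is at least 1/4, so the time |t| is reached within the angle 4 |t|. *)
  set (b := 4 * Rabs t + 1).
  pose proof (Rabs_pos t) as Ht.
  destruct (MVT_derive (time_map r) (time_density r) 0 b) as [c [_ E1]];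
    [unfold b; lra|intros; now apply is_derive_time_map|].
  destruct (MVT_derive (time_map r) (time_density r) (- b) 0) as [c' [_ E2]];
    [unfold b; lra|intros; now apply is_derive_time_map|].
  rewrite time_map_0 in E1, E2.
  pose proof (time_density_ge r c Hr). pose proof (time_density_ge r c' Hr).
  assert (Rabs t <= time_map r b) by (unfold b in *; nra).
  assert (time_map r (- b) <= - Rabs t) by (unfold b in *; nra).
  pose proof (Rle_abs t). pose proof (Rle_abs (- t)). rewrite Rabs_Ropp in *.
  destruct (IVT_gen (time_map r) (- b) b t Hc) as [th [_ E]].
  - rewrite Rmin_left, Rmax_right; lra.
  - exists th; exact E.
Qed.

Definition angle r t := epsilon (inhabits 0) (fun th => time_map r th = t).

Lemma time_map_angle r t : 0 < r < r_s -> time_map r (angle r t) = t.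
Proof.
  intros Hr.
  apply (epsilon_spec (inhabits 0) (fun th => time_map r th = t)), time_map_surj, Hr.
Qed.

Lemma time_map_inj r a b : 0 < r < r_s -> time_map r a = time_map r b -> a = b.
Proof.
  intros Hr E. destruct (Rtotal_order a b) as [L|[L|L]]; auto;
    apply (time_map_lt r) in L; auto; lra.
Qed.

Lemma angle_time_map r th : 0 < r < r_s -> angle r (time_map r th) = th.
Proof. intros Hr. apply (time_map_inj r); auto. now apply time_map_angle. Qed.

Lemma is_derive_angle r t : 0 < r < r_s ->
  is_derive (angle r) t (/ time_density r (angle r t)).
Proof.
  intros Hr. set (th := angle r t).
  assert (Et : time_map r th = t) by (now apply time_map_angle).
  apply (is_derive_inverse (time_map r) (angle r) (th - 1) (th + 1)
    (time_map r (th - 1)) (time_map r (th + 1))).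
  - intros x y [_ Hxy] _; now apply time_map_lt.
  - intros u Hu. split; [|now apply time_map_angle].
    rewrite <- (time_map_angle r u Hr) in Hu.
    split; apply Rnot_le_lt; intros [L|E];
      try (apply (time_map_lt r) in L; auto; lra); rewrite E in Hu; lra.
  - rewrite <- Et at 1 2. split; apply time_map_lt; auto; lra.
  - pose proof (time_density_ge r th Hr). lra.
  - fold th. now apply is_derive_time_map.
Qed.

Lemma angle_period r t : 0 < r < r_s ->
  angle r (t + time_map r (2 * PI)) = angle r t + 2 * PI.
Proof.
  intros Hr. apply (time_map_inj r); auto.
  rewrite time_map_period, !time_map_angle; auto.
Qed.

Definition orbit_x r t := X (r * cos (angle r t)).
Definition orbit_y r t := r * sin (angle r t).

Lemma orbit_x_range r t : 0 < r < r_s -> -1 < orbit_x r t < 1.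
Proof.
  intros Hr. apply X_spec, mul_cos_range; lra.
Qed.

Lemma orbit_solution r : 0 < r < r_s ->
  solution (1 / 2) (-1) (orbit_x r) (orbit_y r).
Proof.
  intros Hr t. pose proof (is_derive_angle r t Hr) as Ha.
  pose proof (mul_cos_range r_s r (angle r t) ltac:(lra)) as Hu.
  pose proof (time_density_ge r (angle r t) Hr) as Hd.
  unfold orbit_x, orbit_y. split.
  - evar_last.
    + apply (is_derive_comp X (fun t => r * cos (angle r t))).
      * apply is_derive_X, Hu.
      * apply is_derive_scal, (is_derive_comp cos (angle r)); [|exact Ha].
        apply is_derive_Reals, derivable_pt_lim_cos.
    + unfold scal; simpl; unfold mult; simpl. fold (time_density r (angle r t)).
      field. lra.
  - evar_last.
    + apply is_derive_scal, (is_derive_comp sin (angle r)); [|exact Ha].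
      apply is_derive_Reals, derivable_pt_lim_sin.
    + unfold scal; simpl; unfold mult; simpl.
      rewrite g_eq. pose proof (X_w _ Hu) as E. fold (time_density r (angle r t)) in E.
      apply (Rmult_eq_reg_r (time_density r (angle r t))); [|lra].
      rewrite E. field. lra.
Qed.

Lemma orbit_H r t : 0 < r < r_s ->
  H (1 / 2) (-1) (orbit_x r t, orbit_y r t) = r ^ 2 / 2.
Proof.
  intros Hr. rewrite H_eq. unfold orbit_x, orbit_y.
  rewrite X_level by (apply mul_cos_range; lra).
  pose proof (sin2_cos2 (angle r t)) as E. unfold Rsqr in E.
  replace ((r * sin (angle r t)) ^ 2 / 2 + 30 * (r * cos (angle r t)) ^ 2 / 60)
    with (r ^ 2 / 2 * (sin (angle r t) * sin (angle r t)
                       + cos (angle r t) * cos (angle r t))) by field.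
  rewrite E; ring.
Qed.

(** A period brings the angle, which increases from 0, back to a multiple of
    2 PI, hence to at least 2 PI. *)
Lemma orbit_minimal_period r : 0 < r < r_s ->
  is_minimal_period (orbit_x r) (orbit_y r) (time_map r (2 * PI)).
Proof.
  intros Hr. pose proof PI_RGT_0.
  split; [split|].
  - rewrite <- (time_map_0 r) at 1. apply time_map_lt; lra.
  - intros t. unfold orbit_x, orbit_y. rewrite angle_period by auto.
    rewrite cos_plus, sin_plus, cos_2PI, sin_2PI. split; f_equal; ring.
  - intros s [Hs Hper]. destruct (Hper 0) as [Ex Ey].
    assert (A0 : angle r 0 = 0) by (rewrite <- (time_map_0 r) at 1; now apply angle_time_map).
    unfold orbit_x, orbit_y in Ex, Ey. rewrite Rplus_0_l, A0, cos_0, ?sin_0 in *.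
    assert (Hsin : sin (angle r s) = 0) by nra.
    assert (Hcos : cos (angle r s) = 1).
    { apply (f_equal U) in Ex.
      rewrite (proj2 (X_spec (r * cos (angle r s)) ltac:(apply mul_cos_range; lra))) in Ex.
      rewrite (proj2 (X_spec (r * 1) ltac:(lra))) in Ex. nra. }
    assert (Ha : 0 < angle r s).
    { apply Rnot_le_lt; intros [L|E].
      - apply (time_map_lt r) in L; auto. rewrite time_map_angle, time_map_0 in L; lra.
      - pose proof (time_map_angle r s Hr) as K. rewrite E, time_map_0 in K; lra. }
    destruct (Rle_lt_dec (2 * PI) (angle r s)) as [L|L].
    + rewrite <- (time_map_angle r s Hr).
      destruct L as [L|<-]; [|lra]. apply Rlt_le, time_map_lt; auto.
    + exfalso. destruct (Rtotal_order (angle r s) PI) as [L'|[E|L']].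
      * pose proof (sin_gt_0 _ Ha L'). lra.
      * rewrite E, cos_PI in Hcos. lra.
      * pose proof (sin_lt_0 _ L' L). lra.
Qed.

Lemma circle_angle r u y : 0 < r -> u ^ 2 + y ^ 2 = r ^ 2 ->
  exists th, u = r * cos th /\ y = r * sin th.
Proof.
  intros Hr E.
  assert (Hur : -1 <= u / r <= 1).
  { split; apply (Rmult_le_reg_r r); auto; unfold Rdiv; rewrite Rmult_assoc, Rinv_l by lra; nra. }
  assert (Ec : u = r * cos (acos (u / r))) by (rewrite cos_acos by auto; field; lra).
  set (a := acos (u / r)) in *. clearbody a.
  pose proof (sin2_cos2 a) as S. unfold Rsqr in S.
  assert (Hsq : (y - r * sin a) * (y + r * sin a) = 0).
  { replace (_ * _) with (y ^ 2 - r ^ 2 * (sin a * sin a)) by ring.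
    replace (sin a * sin a) with (1 - cos a * cos a) by lra.
    rewrite Ec in E. lra. }
  apply Rmult_integral in Hsq as [K|K].
  - exists a; split; [exact Ec|lra].
  - exists (- a); rewrite cos_neg, sin_neg; split; [exact Ec|lra].
Qed.

Lemma orbit_through x y h : 0 < h < 13 / 60 -> -1 < x ->
  H (1 / 2) (-1) (x, y) = h ->
  exists t, x = orbit_x (sqrt (2 * h)) t /\ y = orbit_y (sqrt (2 * h)) t.
Proof.
  intros Hh Hx E. destruct (sqrt_level h Hh) as [Hr Hr2].
  set (r := sqrt (2 * h)) in *. rewrite H_eq in E.
  pose proof (U_sqr x ltac:(lra)) as EU.
  destruct (circle_angle r (U x) y) as [th [Eu Ey]]; [lra|lra|].
  exists (time_map r th). unfold orbit_x, orbit_y. rewrite angle_time_map by auto.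
  split; [|exact Ey]. rewrite <- Eu. symmetry; apply X_unique; [exact Hx|].
  rewrite Eu; apply mul_cos_range; lra.
Qed.

(** * Uniqueness of the period *)

(** D exp (- C t) decreases for t >= 0 and D exp (C t) increases for t <= 0. *)
Lemma gronwall_zero (D dD : R -> R) (C : R) :
  (forall t, is_derive D t (dD t)) -> (forall t, Rabs (dD t) <= C * D t) ->
  (forall t, 0 <= D t) -> D 0 = 0 -> forall t, D t = 0.
Proof.
  intros Hd Hb Hpos H0 t.
  assert (K : forall c s, is_derive (fun s => D s * exp (c * s)) s
                            ((dD s + c * D s) * exp (c * s))).
  { intros c s. evar_last.
    - apply (is_derive_mult D (fun s => exp (c * s))); [apply Hd| |intros; apply Rmult_comm].
      apply (is_derive_comp exp (fun s => c * s)); [apply is_derive_exp|].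
      apply is_derive_scal, is_derive_id.
    - unfold plus, scal, mult, one; simpl; unfold mult; simpl. ring. }
  assert (Hb' : forall s, - (C * D s) <= dD s <= C * D s).
  { intros s. specialize (Hb s). apply Rabs_le_between in Hb. lra. }
  destruct (Rtotal_order t 0) as [L|[->|L]]; [|exact H0|].
  - destruct (MVT_derive _ _ t 0 L (fun s _ => K C s)) as [c [_ E]].
    pose proof (exp_pos (C * c)). pose proof (exp_pos (C * t)).
    pose proof (Hb' c). specialize (Hpos t). rewrite H0 in E.
    assert (0 <= (dD c + C * D c) * exp (C * c)) by (apply Rmult_le_pos; lra).
    assert (D t * exp (C * t) <= 0) by nra.
    nra.
  - destruct (MVT_derive _ _ 0 t L (fun s _ => K (- C) s)) as [c [_ E]].
    pose proof (exp_pos (- C * c)). pose proof (exp_pos (- C * t)).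
    pose proof (Hb' c). specialize (Hpos t). rewrite H0 in E.
    assert (0 <= - (dD c + - C * D c) * exp (- C * c)) by (apply Rmult_le_pos; lra).
    assert (D t * exp (- C * t) <= 0) by nra.
    nra.
Qed.

(** Gronwall applied to the squared distance; the factor c is the difference
    quotient of g minus 1, bounded by 7 for abscissas in (-1, 1). *)
Lemma solution_unique x y x' y' :
  solution (1 / 2) (-1) x y -> solution (1 / 2) (-1) x' y' ->
  (forall t, -1 < x t < 1) -> (forall t, -1 < x' t < 1) ->
  x 0 = x' 0 -> y 0 = y' 0 -> forall t, x t = x' t /\ y t = y' t.
Proof.
  intros S S' B B' Ex Ey t.
  set (D := fun t => (x t - x' t) ^ 2 + (y t - y' t) ^ 2).
  set (dD := fun t => 2 * (x t - x' t) * (- y t - - y' t)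
                      + 2 * (y t - y' t) * (g (1 / 2) (-1) (x t) - g (1 / 2) (-1) (x' t))).
  assert (HD : D t = 0).
  { apply (gronwall_zero D dD 7).
    - intros s. destruct (S s) as [S1 S2], (S' s) as [S3 S4].
      assert (K : forall f f' d d', is_derive f s d -> is_derive f' s d' ->
        is_derive (fun s => (f s - f' s) ^ 2) s (2 * (f s - f' s) * (d - d'))).
      { intros f f' d d' Hf Hf'. evar_last.
        - apply (is_derive_pow (fun s => f s - f' s) 2).
          apply (is_derive_minus (V := R_NormedModule) f f'); eassumption.
        - unfold minus, plus, opp; simpl. ring. }
      apply (is_derive_plus (V := R_NormedModule) (fun s => (x s - x' s) ^ 2)
        (fun s => (y s - y' s) ^ 2)); apply K; assumption.
    - intros s. specialize (B s). specialize (B' s). unfold dD, D, g.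
      set (a := x s) in *. set (b := x' s) in *. set (e := y s - y' s).
      set (c := (a + b) * (a ^ 2 + b ^ 2) - (a + b) / 2 - 1 / 2).
      replace (2 * (a - b) * (- y s - - y' s) + _)
        with (2 * (a - b) * e * c) by (unfold c, e; field).
      assert (Hc : -7 <= c <= 7) by (unfold c; nra).
      apply Rabs_le. pose proof (pow2_ge_0 (a - b + e)). pose proof (pow2_ge_0 (a - b - e)).
      split; nra.
    - intros s. unfold D. pose proof (pow2_ge_0 (x s - x' s)).
      pose proof (pow2_ge_0 (y s - y' s)). lra.
    - unfold D. rewrite Ex, Ey; ring. }
  unfold D in HD. pose proof (pow2_ge_0 (x t - x' t)). pose proof (pow2_ge_0 (y t - y' t)).
  split; apply Rminus_diag_uniq, Rsqr_0_uniq; unfold Rsqr; lra.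
Qed.

Lemma solution_shift alpha beta x y t0 : solution alpha beta x y ->
  solution alpha beta (fun t => x (t + t0)) (fun t => y (t + t0)).
Proof.
  intros S t. destruct (S (t + t0)) as [S1 S2].
  assert (K : forall f d, is_derive f (t + t0) d -> is_derive (fun t : R => f (t + t0) : R) t d).
  { intros f d Hf. evar_last.
    - apply (is_derive_comp f (fun t => t + t0)); [exact Hf|].
      apply (is_derive_plus (V := R_NormedModule) (fun t : R => t) (fun _ => t0));
        [apply is_derive_id|apply is_derive_const].
    - unfold scal, plus, one, zero; simpl; unfold mult; simpl. ring. }
  split; now apply K.
Qed.

(** The line x = -1 carries only energies at least h_s, so an orbit of energy h
    does not cross it; left of it y' = g x > 0, which excludes a period. *)
Lemma periodic_right_of_saddle x y tau h : 0 < h < 13 / 60 ->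
  solution (1 / 2) (-1) x y -> is_period x y tau ->
  (forall t, H (1 / 2) (-1) (x t, y t) = h) -> forall t, -1 < x t.
Proof.
  intros Hh S [Htau Hper] HH.
  assert (Hne : forall t, x t <> -1).
  { intros t E. specialize (HH t). rewrite H_eq, E in HH. unfold p in HH.
    pose proof (pow2_ge_0 (y t)). lra. }
  assert (Hc : continuity x).
  { intros t. apply continuity_pt_filterlim. apply (ex_derive_continuous x).
    exists (- y t). exact (proj1 (S t)). }
  assert (Hside : forall s t, x s < -1 -> -1 < x t -> False).
  { intros s t Hs Ht. destruct (IVT_gen x s t (-1) Hc) as [c [_ E]].
    - rewrite Rmin_left, Rmax_right; lra.
    - exact (Hne c E). }
  intros t. destruct (Rtotal_order (x t) (-1)) as [L|[E|L]]; [exfalso|now elim (Hne t)|lra].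
  assert (Hall : forall s, x s < -1).
  { intros s. destruct (Rtotal_order (x s) (-1)) as [L'|[E|L']]; auto.
    - now elim (Hne s).
    - exfalso; exact (Hside t s L L'). }
  destruct (MVT_derive y (fun s => g (1 / 2) (-1) (x s)) 0 tau Htau) as [c [_ E]].
  - intros s _; apply S.
  - pose proof (proj2 (Hper 0)) as P. rewrite Rplus_0_l in P. rewrite P in E.
    pose proof (Hall c) as Hx. set (z := x c) in *.
    assert (0 < g (1 / 2) (-1) z).
    { unfold g. replace (z * (z + 1)) with ((- z) * (- z - 1)) by ring.
      apply Rmult_lt_0_compat; [apply Rmult_lt_0_compat; lra|nra]. }
    nra.
Qed.

Lemma periodic_orbit_period Gamma tau h : 0 < h < 13 / 60 ->
  periodic_orbit (1 / 2) (-1) Gamma tau ->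
  (forall p, Gamma p -> H (1 / 2) (-1) p = h) -> period h = tau.
Proof.
  intros Hh (x & y & S & Hmin & HG) HH.
  destruct (sqrt_level h Hh) as [Hr Hr2].
  assert (HH' : forall t, H (1 / 2) (-1) (x t, y t) = h)
    by (intros t; apply HH, HG; exists t; reflexivity).
  pose proof (periodic_right_of_saddle x y tau h Hh S (proj1 Hmin) HH') as Hx.
  destruct (orbit_through (x 0) (y 0) h Hh (Hx 0) (HH' 0)) as [t0 [E1 E2]].
  set (r := sqrt (2 * h)) in *.
  assert (Heq : forall t, x t = orbit_x r (t + t0) /\ y t = orbit_y r (t + t0)).
  { apply solution_unique; auto.
    - apply solution_shift, orbit_solution, Hr.
    - intros t. destruct (orbit_through (x t) (y t) h Hh (Hx t) (HH' t)) as [s [E _]].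
      rewrite E. apply orbit_x_range, Hr.
    - intros t; apply orbit_x_range, Hr.
    - now rewrite Rplus_0_l.
    - now rewrite Rplus_0_l. }
  rewrite period_eq_RInt by exact Hh. fold r.
  destruct (orbit_minimal_period r Hr) as [Hp0 Hmin0].
  destruct Hmin as [Hp Hmin]. apply Rle_antisym.
  - apply Hmin0. split; [apply Hp|]. intros t.
    destruct Hp as [_ Hp]. destruct (Hp (t - t0)) as [P1 P2].
    destruct (Heq (t - t0)) as [Q1 Q2]. destruct (Heq (t - t0 + tau)) as [Q3 Q4].
    replace (t - t0 + t0) with t in * by ring.
    replace (t - t0 + tau + t0) with (t + tau) in * by ring.
    split; congruence.
  - apply Hmin. split; [apply Hp0|]. intros t.
    destruct Hp0 as [_ Hp0]. destruct (Hp0 (t + t0)) as [P1 P2].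
    destruct (Heq t) as [Q1 Q2]. destruct (Heq (t + time_map r (2 * PI))) as [Q3 Q4].
    replace (t + time_map r (2 * PI) + t0) with (t + t0 + time_map r (2 * PI)) in * by ring.
    split; congruence.
Qed.

Definition orbit r (p : R * R) : Prop := exists t, p = (orbit_x r t, orbit_y r t).

Lemma orbit_periodic h : 0 < h < 13 / 60 ->
  periodic_orbit (1 / 2) (-1) (orbit (sqrt (2 * h))) (period h).
Proof.
  intros Hh. destruct (sqrt_level h Hh) as [Hr _].
  exists (orbit_x (sqrt (2 * h))), (orbit_y (sqrt (2 * h))). split; [|split].
  - now apply orbit_solution.
  - rewrite period_eq_RInt by exact Hh. now apply orbit_minimal_period.
  - intros q0; reflexivity.
Qed.

Lemma orbit_level h p : 0 < h < 13 / 60 -> orbit (sqrt (2 * h)) p ->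
  -1 < fst p /\ H (1 / 2) (-1) p = h.
Proof.
  intros Hh [t ->]. destruct (sqrt_level h Hh) as [Hr Hr2]. split.
  - apply orbit_x_range, Hr.
  - rewrite orbit_H by exact Hr. lra.
Qed.

(** * The period annulus *)

(** A separation of W splits some segment from the origin into two open pieces,
    and the function equal to -1 on one and 1 on the other would be continuous. *)
Lemma star_shaped_connected (W : R * R -> Prop) : open W ->
  (forall p l, W p -> 0 <= l <= 1 -> W (l * fst p, l * snd p)) -> connected W.
Proof.
  intros HW Hstar.
  assert (K : forall A B : R * R -> Prop, open A -> open B ->
    (forall p, W p -> A p \/ B p) -> forall p, W p -> A (0, 0) -> B p ->
    exists p, W p /\ A p /\ B p).
  { intros A B HA HB Hcov p Wp A0 Bp.
    destruct (classic (exists p, W p /\ A p /\ B p)) as [?|Hno]; [assumption|exfalso].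
    set (ray := fun l : R => (l * fst p, l * snd p)).
    assert (Hray : forall l, continuous ray l).
    { intros l P [e He].
      assert (Hl : forall c, continuous (fun l : R => l * c) l).
      { intros c. apply (ex_derive_continuous (fun l : R => l * c)). auto_derive; auto. }
      pose proof (Hl (fst p) _ (locally_ball (l * fst p) e)) as H1.
      pose proof (Hl (snd p) _ (locally_ball (l * snd p) e)) as H2.
      apply (filter_imp (F := locally l) (fun s =>
        ball (l * fst p) e (s * fst p) /\ ball (l * snd p) e (s * snd p))).
      - intros s [B1 B2]. apply He. split; assumption.
      - apply (filter_and (F := locally l)); assumption. }
    set (f := fun l => if excluded_middle_informative (A (ray l)) then -1 else 1).
    assert (f0 : f 0 = -1).
    { unfold f, ray. rewrite !Rmult_0_l.
      destruct excluded_middle_informative; tauto. }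
    assert (f1 : f 1 = 1).
    { unfold f, ray. rewrite !Rmult_1_l, <- surjective_pairing.
      destruct excluded_middle_informative as [Ap|]; [|reflexivity].
      elim Hno; exists p; auto. }
    destruct (IVT_sign f 0 1) as [c [_ E]].
    - lra.
    - intros l Hl. pose proof (Hstar p l Wp Hl) as Wl. fold (ray l) in Wl.
      destruct (Hcov _ Wl) as [Al|Bl].
      + apply (continuous_ext_loc _ (fun _ => -1)); [|apply continuous_const].
        apply (filter_imp (F := locally l) (fun s => A (ray s))).
        * intros s As. unfold f. destruct excluded_middle_informative; tauto.
        * exact (Hray l _ (HA _ Al)).
      + apply (continuous_ext_loc _ (fun _ => 1)); [|apply continuous_const].
        apply (filter_imp (F := locally l) (fun s => W (ray s) /\ B (ray s))).
        * intros s [Ws Bs].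
          unfold f. destruct excluded_middle_informative as [As|]; [|reflexivity].
          elim Hno; exists (ray s); auto.
        * apply (filter_and (F := locally l)).
          -- exact (Hray l _ (HW _ Wl)).
          -- exact (Hray l _ (HB _ Bl)).
    - rewrite f0, f1; lra.
    - unfold f in E. destruct excluded_middle_informative; lra. }
  intros A B HA HB Hcov [a [Wa Aa]] [b [Wb Bb]].
  pose proof (Hstar a 0 Wa ltac:(lra)) as W0. rewrite !Rmult_0_l in W0.
  destruct (Hcov _ W0) as [A0|B0].
  - exact (K A B HA HB Hcov b Wb A0 Bb).
  - destruct (K B A HB HA (fun p Wp => proj1 (or_comm _ _) (Hcov p Wp)) a Wa B0 Aa)
      as (c & Wc & Bc & Ac). exists c; auto.
Qed.

(** The region inside the homoclinic loop. *)
Definition well (p : R * R) : Prop := -1 < fst p /\ H (1 / 2) (-1) p < 13 / 60.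

Definition annulus (p : R * R) : Prop := -1 < fst p /\ 0 < H (1 / 2) (-1) p < 13 / 60.

Lemma well_iff p : well p <-> annulus p \/ p = origin.
Proof.
  destruct p as [x y]. unfold well, annulus, origin; simpl fst.
  rewrite H_eq. split.
  - intros [Hx Hh]. pose proof (p_pos x ltac:(lra)) as Hp.
    pose proof (pow2_ge_0 x) as Sx. pose proof (pow2_ge_0 y) as Sy.
    destruct (Req_dec x 0) as [->|Nx]; [destruct (Req_dec y 0) as [->|Ny]|].
    + right; reflexivity.
    + left. pose proof (pow2_gt_0 y Ny). unfold p in *. lra.
    + left. pose proof (Rmult_lt_0_compat _ _ (pow2_gt_0 x Nx) Hp). lra.
  - intros [Hh|E]; [lra|]. injection E as -> ->. unfold p. lra.
Qed.

Lemma open_well : open well.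
Proof.
  assert (HH : forall p, continuous (H (1 / 2) (-1)) p).
  { intros p0.
    apply (continuous_ext (fun z : R * R => plus (snd z ^ 2 / 2) (fst z ^ 2 * p (fst z) / 60))).
    - intros [x y]; symmetry; apply H_eq.
    - apply (continuous_plus (V := R_NormedModule)
        (U := prod_UniformSpace R_UniformSpace R_UniformSpace)).
      + apply (continuous_comp snd (fun y => y ^ 2 / 2)); [apply continuous_snd|].
        apply (ex_derive_continuous (fun y => y ^ 2 / 2)). auto_derive; auto.
      + apply (continuous_comp fst (fun x => x ^ 2 * p x / 60)); [apply continuous_fst|].
        apply (ex_derive_continuous (fun x => x ^ 2 * p x / 60)).
        unfold p; auto_derive; auto. }
  apply open_and.
  - apply (open_comp fst (fun x => -1 < x)); [|apply open_gt].
    intros [x y] _; apply continuous_fst.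
  - apply (open_comp (H (1 / 2) (-1)) (fun h => h < 13 / 60)); [|apply open_lt].
    intros z _; apply HH.
Qed.

(** G decreases towards 0 along both sides, so H decreases along rays towards
    the origin. *)
Lemma well_star p l : well p -> 0 <= l <= 1 -> well (l * fst p, l * snd p).
Proof.
  destruct p as [x y]; unfold well; simpl fst; simpl snd. rewrite !H_eq.
  intros [Hx Hh] Hl.
  assert (Hlx : -1 < l * x) by (destruct (Rle_lt_dec 0 x); nra). split; [exact Hlx|].
  assert ((l * y) ^ 2 <= y ^ 2).
  { rewrite Rpow_mult_distr. pose proof (pow2_ge_0 y).
    assert (l ^ 2 <= 1) by nra. rewrite <- (Rmult_1_l (y ^ 2)) at 2.
    apply Rmult_le_compat_r; assumption. }
  assert ((l * x) ^ 2 * p (l * x) <= x ^ 2 * p x).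
  { destruct (Req_dec (l * x) x) as [->|N]; [lra|]. apply Rlt_le.
    destruct (Rle_lt_dec 0 x) as [L|L].
    - assert (0 <= l * x) by nra. assert (l * x <= x) by nra.
      apply level_lt_right; lra.
    - assert (l * x <= 0) by nra. assert (x <= l * x) by nra.
      apply level_lt_left; lra. }
  lra.
Qed.

Lemma annulus_subset z : annulus z -> period_annulus (1 / 2) (-1) z.
Proof.
  intros Hz. exists annulus. split; [|split; [|exact Hz]].
  - split; [|split].
    + unfold annulus, origin. rewrite H_eq. intros [_ [L _]]. unfold p in L. lra.
    + apply (open_ext well); [apply well_iff|apply open_well].
    + apply star_shaped_connected.
      * apply (open_ext well); [apply well_iff|apply open_well].
      * intros q0 l Hq Hl. apply well_iff, well_star; [now apply well_iff|exact Hl].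
  - intros [x y] Hq. set (h := H (1 / 2) (-1) (x, y)).
    destruct Hq as [Hx Hh]. fold h in Hh. simpl in Hx.
    exists (orbit (sqrt (2 * h))), (period h). split; [now apply orbit_periodic|split].
    + destruct (orbit_through x y h Hh Hx eq_refl) as [t [Ex Ey]].
      exists t. now f_equal.
    + intros q0 Hq0. destruct (orbit_level h q0 Hh Hq0) as [L E]. split; [exact L|]. now rewrite E.
Qed.

Theorem theorem5p1 :
  exists T : R -> R,
    is_period_function (1 / 2) (-1) T /\
    exactly_two (critical_period (1 / 2) (-1) T).
Proof.
  exists period. split.
  - intros h Hh. rewrite h_s_eq in Hh. split.
    + exists (orbit (sqrt (2 * h))). split; [now apply orbit_periodic|].
      intros q0 Hq. destruct (orbit_level h q0 Hh Hq) as [L E]. split; [|exact E].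
      apply annulus_subset. split; [exact L|]. now rewrite E.
    + intros tau (Gamma & HG & HH).
      apply (periodic_orbit_period Gamma tau h Hh HG). intros q0 Hq; now apply HH.
  - unfold critical_period. rewrite h_s_eq. exact period_exactly_two_extrema.
Qed.
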